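(* Let $f\in C([0,1]\times\mathbb{R}^2,\mathbb{R})$ and $k\in C([0,1]\times[0,1],\mathbb{R})$ with $k\ge0$, and consider the boundary value problem $$y^{(4)}(x)=f\Big(x,y(x),\int_0^1k(x,t)y(t)\,dt\Big),\ x\in(0,1),\qquad y(0)=y(1)=y''(0)=y''(1)=0. \tag{P}$$ Assume that there exist a lower solution $\alpha$ and an upper solution $\beta$ of (P) with $\alpha(x)\le\beta(x)$ for all $x\in[0,1]$. Assume also that there exist constants $M,N>0$ with $M<c_1$ and $$\|k\|_\infty:=\max_{(x,t)\in[0,1]\times[0,1]}|k(x,t)|<\frac{1}{N\max_{x\in[0,1]}\int_0^1G(x,s)\,ds},$$ where $G=G_M$ is the Green function of $y^{(4)}+My$ with boundary conditions $y(0)=y(1)=y''(0)=y''(1)=0$, such that $$f(x,u_1,v_1)-f(x,u_2,v_2)\ge -M(u_1-u_2)+N(v_1-v_2)$$ for all $x\in[0,1]$ and all $u_1,u_2,v_1,v_2\in\mathbb{R}$ with $$\alpha(x)\le u_2\le u_1\le\beta(x),\qquad \int_0^1k(x,t)\alpha(t)\,dt\le v_2\le v_1\le\int_0^1k(x,t)\beta(t)\,dt.$$ Let $\{\alpha_n\}$ and $\{\beta_n\}$ be the sequences produced by the iterative procedure $$Ly_n(x)=f\Big(x,y_{n-1}(x),\int_0^1k(x,t)y_{n-1}(t)\,dt\Big)+My_{n-1}(x)-N\int_0^1k(x,t)y_{n-1}(t)\,dt,$$ $$y_n(0)=y_n(1)=y_n''(0)=y_n''(1)=0,\qquad n=1,2,\dots,$$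 with initial functions $y_0=\alpha$ and $y_0=\beta$ respectively (so $\alpha_0=\alpha$, $\beta_0=\beta$), where $Ly(x):=y^{(4)}(x)+My(x)-N\int_0^1k(x,t)y(t)\,dt$. Then $$\alpha_{n-1}\le\alpha_n\le\beta_n\le\beta_{n-1}\quad\text{on }[0,1],\qquad n=1,2,\dots,$$ and $\{\alpha_n\}$ and $\{\beta_n\}$ converge uniformly on $[0,1]$ to the extremal solutions of (P) in $[\alpha,\beta]$, i.e. to the minimal and the maximal solution of (P) in $[\alpha,\beta]$, respectively.
   Context: Functions are real-valued. A function $\alpha\in C^4[0,1]$ is a lower solution of (P) if $\alpha^{(4)}(x)\le f(x,\alpha(x),\int_0^1k(x,t)\alpha(t)\,dt)$ for $x\in(0,1)$ and $\alpha(0)\le0$, $\alpha(1)\le0$, $\alpha''(0)\ge0$, $\alpha''(1)\ge0$. An upper solution $\beta\in C^4[0,1]$ is defined by reversing all these inequalities. $[\alpha,\beta]$ denotes the set of continuous functions $u$ on $[0,1]$ with $\alpha(x)\le u(x)\le\beta(x)$ for all $x$. Solutions $\underline y,\overline y\in[\alpha,\beta]$ of (P) are minimal and maximal (extremal) in $[\alpha,\beta]$ if every solution $y\in[\alpha,\beta]$ of (P) satisfies $\underline y\le y\le\overline y$ on $[0,1]$. For $M>0$, $G=G_M:[0,1]\times[0,1]\to\mathbb{R}$ is the unique continuous function such that for every $q\in C[0,1]$ the function $y(x)=\int_0^1G(x,s)q(s)\,ds$ is the unique $C^4[0,1]$ solution of $y^{(4)}(x)+My(x)=q(x)$ on $(0,1)$,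 $y(0)=y(1)=y''(0)=y''(1)=0$. The constant $c_1$ is $c_1=4k_1^4\approx125.14$, where $k_1\approx2.365$ is the smallest positive solution of $\tan k=-\tanh k$. Let $w$ and $\chi$ be the unique solutions of $y^{(4)}+My=0$ with, respectively, $y(0)=1,\ y''(0)=y(1)=y''(1)=0$, and $y(0)=0,\ y''(0)=1,\ y(1)=y''(1)=0$. It is known (Cabada, Cid, Sanchez, 2007) that for $0<M\le c_1$ one has $w\ge0$, $\chi\le0$ on $[0,1]$ and $G_M\ge0$ on $[0,1]\times[0,1]$. Under the stated bound on $\|k\|_\infty$, for every $p\in C[0,1]$ the problem $Ly=p$, $y(0)=y(1)=y''(0)=y''(1)=0$ has exactly one solution in $C^4[0,1]$, so the iteration is well defined. *)

(* Defs.v *)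
From Stdlib Require Import Reals Lra.
From Coquelicot Require Import Coquelicot.
Local Open Scope R_scope.

(* Functions on [0,1] are represented by total functions on R; every notion
   below depends only on their values on [0,1]. *)
Definition I01 (x : R) : Prop := 0 <= x <= 1.

(* y is of class C^n on [0,1] and d i is its i-th derivative there.  D_in takes
   the limit of the difference quotient relative to [0,1], hence derivatives are
   one-sided at 0 and 1; they are unique, so d is determined by y on [0,1]. *)
Definition is_Cn (n : nat) (y : R -> R) (d : nat -> R -> R) : Prop :=
  (forall x, I01 x -> d 0%nat x = y x) /\
  (forall i x, (i < n)%nat -> I01 x -> D_in (d i) (d (S i)) I01 x) /\
  continuous_on I01 (d n).

Definition navier (y : R -> R) (d : nat -> R -> R) : Prop :=
  y 0 = 0 /\ y 1 = 0 /\ d 2%nat 0 = 0 /\ d 2%nat 1 = 0.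

Definition Kint (k : R -> R -> R) (y : R -> R) (x : R) : R :=
  RInt (fun t => k x t * y t) 0 1.

Definition continuous_f (f : R -> R -> R -> R) : Prop :=
  continuous_on (fun p : R * R * R => I01 (fst (fst p)))
    (fun p => f (fst (fst p)) (snd (fst p)) (snd p)).

Definition continuous_square (k : R -> R -> R) : Prop :=
  continuous_on (fun p : R * R => I01 (fst p) /\ I01 (snd p))
    (fun p => k (fst p) (snd p)).

Definition lower_solution (f : R -> R -> R -> R) (k : R -> R -> R)
    (alpha : R -> R) : Prop :=
  exists d, is_Cn 4 alpha d /\
    (forall x, 0 < x < 1 -> d 4%nat x <= f x (alpha x) (Kint k alpha x)) /\
    alpha 0 <= 0 /\ alpha 1 <= 0 /\ d 2%nat 0 >= 0 /\ d 2%nat 1 >= 0.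

Definition upper_solution (f : R -> R -> R -> R) (k : R -> R -> R)
    (beta : R -> R) : Prop :=
  exists d, is_Cn 4 beta d /\
    (forall x, 0 < x < 1 -> d 4%nat x >= f x (beta x) (Kint k beta x)) /\
    beta 0 >= 0 /\ beta 1 >= 0 /\ d 2%nat 0 <= 0 /\ d 2%nat 1 <= 0.

Definition solution (f : R -> R -> R -> R) (k : R -> R -> R)
    (y : R -> R) : Prop :=
  exists d, is_Cn 4 y d /\
    (forall x, 0 < x < 1 -> d 4%nat x = f x (y x) (Kint k y x)) /\
    navier y d.

Definition between (alpha beta u : R -> R) : Prop :=
  continuous_on I01 u /\ forall x, I01 x -> alpha x <= u x <= beta x.

Definition extremal_solutions (f : R -> R -> R -> R) (k : R -> R -> R)
    (alpha beta ymin ymax : R -> R) : Prop :=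
  (solution f k ymin /\ between alpha beta ymin) /\
  (solution f k ymax /\ between alpha beta ymax) /\
  (forall y, solution f k y -> between alpha beta y ->
     forall x, I01 x -> ymin x <= y x <= ymax x).

Definition linear_solution (M : R) (q y : R -> R) : Prop :=
  exists d, is_Cn 4 y d /\
    (forall x, 0 < x < 1 -> d 4%nat x + M * y x = q x) /\
    navier y d.

(* The Green function is specified by its defining property, which determines
   it on [0,1] x [0,1]. *)
Definition is_green (M : R) (G : R -> R -> R) : Prop :=
  continuous_square G /\
  forall q, continuous_on I01 q ->
    linear_solution M q (fun x => RInt (fun s => G x s * q s) 0 1) /\
    (forall z, linear_solution M q z ->
       forall x, I01 x -> z x = RInt (fun s => G x s * q s) 0 1).

(* The guard cos k <> 0 makes explicit that tan is defined at k, since Stdlib's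
   tan is total. *)
Definition tan_tanh_root (k : R) : Prop :=
  0 < k /\ cos k <> 0 /\ tan k = - tanh k.

Definition is_c1 (c1 : R) : Prop :=
  exists k1, tan_tanh_root k1 /\ (forall k, tan_tanh_root k -> k1 <= k) /\
    c1 = 4 * k1 ^ 4.

Definition is_max (E : R -> Prop) (m : R) : Prop :=
  E m /\ is_upper_bound E m.

Definition is_sup_norm (k : R -> R -> R) (m : R) : Prop :=
  is_max (fun r => exists x t, I01 x /\ I01 t /\ r = Rabs (k x t)) m.

Definition is_max_int_green (G : R -> R -> R) (m : R) : Prop :=
  is_max (fun r => exists x, I01 x /\ r = RInt (fun s => G x s) 0 1) m.

Definition Lop (M N : R) (k : R -> R -> R) (y : R -> R)
    (d : nat -> R -> R) (x : R) : R :=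
  d 4%nat x + M * y x - N * Kint k y x.

Definition iteration (M N : R) (f : R -> R -> R -> R) (k : R -> R -> R)
    (y0 : R -> R) (y : nat -> R -> R) : Prop :=
  (forall x, I01 x -> y 0%nat x = y0 x) /\
  forall n, exists d, is_Cn 4 (y (S n)) d /\
    (forall x, 0 < x < 1 ->
       Lop M N k (y (S n)) d x =
         f x (y n x) (Kint k (y n) x) + M * y n x - N * Kint k (y n) x) /\
    navier (y (S n)) d.

Definition unif_cv (u : nat -> R -> R) (l : R -> R) : Prop :=
  forall eps, 0 < eps -> exists n0 : nat, forall n x,
    (n0 <= n)%nat -> I01 x -> Rabs (u n x - l x) < eps.

(* Main.v *)
Require Import Defs.
From Stdlib Require Import Reals Lra Lia ClassicalEpsilon.
From Coquelicot Require Import Coquelicot.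
Local Open Scope R_scope.

(** The engine is a maximum principle: if L y = y'''' + M y - N K y, where K y
    is the integral of k(x,t) y(t), satisfies L y >= 0 on (0,1), with
    y(0), y(1) >= 0 and y''(0), y''(1) <= 0, then y >= 0
    ([nonlocal_inverse_positive]).  Given it, the rest is the classical
    monotone iteration.  The one-sided condition on f says that
    F u = f(x, u, K u) + M u - N K u is increasing between alpha and beta
    ([rhs_monotone]), so the step u |-> L^-1 (F u) preserves order
    ([iterate_mono]).  Since L alpha <= F alpha and F beta <= L beta, with
    favourable boundary values, the first steps stay inside the strip and
    order is then inherited by all later ones.  A solution y of (P) in the
    strip is its own successor, whence alpha_n <= y <= beta_n for all n, which
    is the extremality of the limits.

    The maximum principle without the integral term
    ([beam_inverse_positive]) is where the bound M < c1 enters.  Write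
    M = 4 m^4.  Reflecting the simply supported beam oddly at both ends gives
    its Green function in the form

      G(x,s) = c (h (1 - |x - s|) - h (s + x - 1)),   c > 0,

    for one even solution h of h'''' + M h = 0 with h'(1) = 0 ([profile]).
    Hence G >= 0 follows from h' >= 0 on [0,1], which is the decrease of
    tanh/tan on (0, PI).  The influence of the boundary data is governed by h'
    and h''' at the points 1 - x and x; the inequality h''' <= 0 on [0,1] comes
    from sin m cosh m + cos m sinh m > 0, which holds as long as m stays below
    the first root k1 of tan k = - tanh k.  Instead of
    integrating against G one compares the Lagrange bilinear form of y and
    G(x,.) at the ends of [0,x] and [x,1], where it is monotone
    ([lagrange_le]).

    The integral term is then absorbed by the smallness of k: if - mu < 0 is
    the minimum of y and e solves e'''' + M e = 1, then
    y + N ||k|| mu e >= 0, so mu <= N ||k|| mu max e < mu, which is absurd.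

    For the convergence ([iteration_converges]): the iterates are monotone and
    bounded, so they converge pointwise; their fourth derivatives are uniformly
    bounded, and the boundary conditions turn this into a common Lipschitz
    constant ([navier_lipschitz]), so the limit y is continuous and the
    convergence is uniform by Dini's theorem.  The functions
    q_n = F y_n + N K y_(n+1) are monotone in n as well, so Dini's theorem
    applies to them too, and one may pass to the limit in
    y_(n+1)(x) = integral of G(x,s) q_n(s). *)

(** * Continuity and integration on [0,1] *)

(** Composing with the retraction onto [0,1] turns continuity relative to
    [0,1] into continuity on the line, which is what the extreme value,
    integrability and mean value theorems ask for. *)
Definition clamp (t : R) : R := Rmax 0 (Rmin 1 t).

Lemma clamp_I01 t : I01 (clamp t).
Proof. unfold clamp, I01, Rmax, Rmin. repeat destruct Rle_dec; lra. Qed.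

Lemma clamp_id t : I01 t -> clamp t = t.
Proof. unfold clamp, I01, Rmax, Rmin. intros; repeat destruct Rle_dec; lra. Qed.

Lemma clamp_contracting x y : Rabs (clamp x - clamp y) <= Rabs (x - y).
Proof.
  unfold clamp, Rmax, Rmin; repeat destruct Rle_dec;
    unfold Rabs; repeat destruct Rcase_abs; lra.
Qed.

Lemma continuous_on_I01_eps (g : R -> R) :
  continuous_on I01 g <->
  forall x, I01 x -> forall eps, 0 < eps -> exists delta, 0 < delta /\
    forall y, I01 y -> Rabs (y - x) < delta -> Rabs (g y - g x) < eps.
Proof.
  split.
  - intros H x Hx eps Heps.
    specialize (H x Hx). rewrite filterlim_locally in H.
    destruct (H (mkposreal _ Heps)) as [d Hd].
    exists d; split; [apply cond_pos|].
    intros y Hy Hyx. exact (Hd y Hyx Hy).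
  - intros H x Hx. apply filterlim_locally. intros eps.
    destruct (H x Hx eps (cond_pos eps)) as [d [Hd H1]].
    exists (mkposreal d Hd). intros y Hyx Hy. exact (H1 y Hy Hyx).
Qed.

Lemma continuous_f_eps f : continuous_f f ->
  forall x u v, I01 x -> forall eps, 0 < eps -> exists delta, 0 < delta /\
    forall x' u' v', I01 x' -> Rabs (x' - x) < delta -> Rabs (u' - u) < delta ->
      Rabs (v' - v) < delta -> Rabs (f x' u' v' - f x u v) < eps.
Proof.
  intros H x u v Hx eps Heps.
  specialize (H (x, u, v) Hx). rewrite filterlim_locally in H.
  destruct (H (mkposreal _ Heps)) as [d Hd].
  exists d; split; [apply cond_pos|].
  intros x' u' v' Hx' H1 H2 H3.
  apply (Hd (x', u', v')); [split; [split|]|]; assumption.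
Qed.

Lemma continuous_square_eps k : continuous_square k ->
  forall x t, I01 x -> I01 t -> forall eps, 0 < eps -> exists delta, 0 < delta /\
    forall x' t', I01 x' -> I01 t' -> Rabs (x' - x) < delta ->
      Rabs (t' - t) < delta -> Rabs (k x' t' - k x t) < eps.
Proof.
  intros H x t Hx Ht eps Heps.
  specialize (H (x, t) (conj Hx Ht)). rewrite filterlim_locally in H.
  destruct (H (mkposreal _ Heps)) as [d Hd].
  exists d; split; [apply cond_pos|].
  intros x' t' Hx' Ht' H1 H2.
  apply (Hd (x', t')); [split|split]; assumption.
Qed.

Lemma continuity_clamp (g : R -> R) : continuous_on I01 g ->
  forall t, continuity_pt (fun s => g (clamp s)) t.
Proof.
  intros H t. apply continuity_pt_filterlim, filterlim_locally. intros eps.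
  rewrite continuous_on_I01_eps in H.
  destruct (H (clamp t) (clamp_I01 t) eps (cond_pos eps)) as [d [Hd H1]].
  exists (mkposreal d Hd). intros y Hy.
  apply H1; [apply clamp_I01|].
  eapply Rle_lt_trans; [apply clamp_contracting|exact Hy].
Qed.

Lemma continuous_on_ext (g h : R -> R) : (forall x, I01 x -> g x = h x) ->
  continuous_on I01 g -> continuous_on I01 h.
Proof.
  intros He. rewrite !continuous_on_I01_eps. intros H x Hx eps Heps.
  destruct (H x Hx eps Heps) as [d [Hd H1]]. exists d; split; [easy|].
  intros y Hy Hyx. rewrite <- !He by assumption. now apply H1.
Qed.

Lemma continuous_on_const (c : R) : continuous_on (U := R_UniformSpace) I01 (fun _ => c).
Proof. intros x Hx. apply filterlim_const. Qed.

Lemma continuous_on_plus (g h : R -> R) : continuous_on I01 g -> continuous_on I01 h ->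
  continuous_on I01 (fun x => g x + h x).
Proof.
  intros Hg Hh x Hx.
  apply (filterlim_comp_2 (G := locally (g x)) (H := locally (h x)));
    [exact (Hg x Hx) | exact (Hh x Hx) | apply (filterlim_plus (g x) (h x))].
Qed.

Lemma continuous_on_mult (g h : R -> R) : continuous_on I01 g -> continuous_on I01 h ->
  continuous_on I01 (fun x => g x * h x).
Proof.
  intros Hg Hh x Hx.
  apply (filterlim_comp_2 (G := locally (g x)) (H := locally (h x)));
    [exact (Hg x Hx) | exact (Hh x Hx) | apply (filterlim_mult (g x) (h x))].
Qed.

Lemma continuous_on_lincomb a b (g h : R -> R) : continuous_on I01 g -> continuous_on I01 h ->
  continuous_on I01 (fun x => a * g x + b * h x).
Proof.
  intros. apply continuous_on_plus; apply continuous_on_mult;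
    auto using continuous_on_const.
Qed.

Lemma continuous_on_min (g : R -> R) : continuous_on I01 g ->
  exists x0, I01 x0 /\ forall x, I01 x -> g x0 <= g x.
Proof.
  intros H.
  destruct (continuity_ab_min (fun t => g (clamp t)) 0 1) as [x0 [H1 H2]].
  - lra.
  - intros; now apply continuity_clamp.
  - exists x0; split; [exact H2|]. intros x Hx. specialize (H1 x Hx).
    cbv beta in H1. now rewrite !clamp_id in H1.
Qed.

Lemma continuous_on_bounded (g : R -> R) : continuous_on I01 g ->
  exists C, 0 <= C /\ forall x, I01 x -> Rabs (g x) <= C.
Proof.
  intros H.
  destruct (continuous_on_min g H) as [x0 [_ H1]].
  destruct (continuous_on_min (fun x => -1 * g x + 0 * g x)) as [x1 [_ H2]].
  { now apply continuous_on_lincomb. }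
  exists (Rmax (Rabs (g x0)) (Rabs (g x1))). split.
  { eapply Rle_trans; [apply Rabs_pos|apply Rmax_l]. }
  intros x Hx. specialize (H1 x Hx); specialize (H2 x Hx).
  apply Rabs_le. unfold Rmax, Rabs; repeat destruct Rle_dec; repeat destruct Rcase_abs; lra.
Qed.

Lemma ex_RInt_I01 (g : R -> R) : continuous_on I01 g -> ex_RInt g 0 1.
Proof.
  intros H. apply ex_RInt_ext with (f := fun t => g (clamp t)).
  - rewrite Rmin_left, Rmax_right by lra. intros x Hx.
    rewrite clamp_id; [easy|unfold I01; lra].
  - apply (ex_RInt_continuous (V := R_CompleteNormedModule)).
    intros z _. apply continuity_pt_filterlim. now apply continuity_clamp.
Qed.

Lemma RInt_I01_mono (g h : R -> R) : continuous_on I01 g -> continuous_on I01 h ->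
  (forall x, I01 x -> g x <= h x) -> RInt g 0 1 <= RInt h 0 1.
Proof.
  intros Hg Hh H. apply RInt_le; try (now apply ex_RInt_I01); [lra|].
  intros x Hx. apply H. unfold I01; lra.
Qed.

Lemma RInt_I01_lincomb a b (g h : R -> R) : continuous_on I01 g -> continuous_on I01 h ->
  RInt (fun t => a * g t + b * h t) 0 1 = a * RInt g 0 1 + b * RInt h 0 1.
Proof.
  intros Hg Hh. apply is_RInt_unique.
  apply (is_RInt_plus (V := R_NormedModule) (fun t => a * g t) (fun t => b * h t));
    apply (is_RInt_scal (V := R_NormedModule));
    apply (RInt_correct (V := R_CompleteNormedModule)); now apply ex_RInt_I01.
Qed.

Lemma RInt_I01_diff_le (g h : R -> R) c : continuous_on I01 g -> continuous_on I01 h ->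
  (forall t, I01 t -> Rabs (g t - h t) <= c) ->
  Rabs (RInt g 0 1 - RInt h 0 1) <= c.
Proof.
  intros Hg Hh H.
  assert (E := RInt_I01_lincomb 1 (-1) g h Hg Hh).
  replace (RInt g 0 1 - RInt h 0 1) with (1 * RInt g 0 1 + -1 * RInt h 0 1) by ring.
  rewrite <- E.
  replace c with ((1 - 0) * c) by ring.
  apply abs_RInt_le_const; [lra| |].
  - apply ex_RInt_I01. now apply continuous_on_lincomb.
  - intros t Ht. replace (1 * g t + -1 * h t) with (g t - h t) by ring. now apply H.
Qed.

Lemma RInt_I01_ext (g h : R -> R) : (forall t, I01 t -> g t = h t) -> RInt g 0 1 = RInt h 0 1.
Proof.
  intros H. apply RInt_ext. rewrite Rmin_left, Rmax_right by lra.
  intros x Hx. apply H. unfold I01; lra.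
Qed.

Lemma continuous_square_slice k x : continuous_square k -> I01 x ->
  continuous_on I01 (k x).
Proof.
  intros H Hx. apply continuous_on_I01_eps. intros t Ht eps Heps.
  destruct (continuous_square_eps k H x t Hx Ht eps Heps) as [d [Hd H1]].
  exists d; split; [easy|]. intros t' Ht' Htt. apply H1; try assumption.
  now rewrite Rminus_diag, Rabs_R0.
Qed.

(** * The integral operator *)

Lemma continuous_on_kernel k y x : continuous_square k -> continuous_on I01 y ->
  I01 x -> continuous_on I01 (fun t => k x t * y t).
Proof.
  intros. apply continuous_on_mult; [now apply continuous_square_slice|easy].
Qed.

Lemma Kint_mono k y z x : continuous_square k ->
  (forall x t, I01 x -> I01 t -> 0 <= k x t) ->
  continuous_on I01 y -> continuous_on I01 z ->
  (forall t, I01 t -> y t <= z t) -> I01 x -> Kint k y x <= Kint k z x.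
Proof.
  intros Hk Hk0 Hy Hz H Hx. apply RInt_I01_mono; try now apply continuous_on_kernel.
  intros t Ht. apply Rmult_le_compat_l; auto.
Qed.

Lemma Kint_lincomb k a b y z x : continuous_square k ->
  continuous_on I01 y -> continuous_on I01 z -> I01 x ->
  Kint k (fun t => a * y t + b * z t) x = a * Kint k y x + b * Kint k z x.
Proof.
  intros Hk Hy Hz Hx. unfold Kint.
  rewrite <- RInt_I01_lincomb by now apply continuous_on_kernel.
  apply RInt_I01_ext. intros; ring.
Qed.

Lemma continuous_on_Kint k y : continuous_square k -> continuous_on I01 y ->
  continuous_on I01 (Kint k y).
Proof.
  intros Hk Hy. apply continuous_on_I01_eps. intros x Hx eps Heps.
  destruct (continuous_on_bounded y Hy) as [C [HC HyC]].
  assert (He : 0 < eps / (2 * (C + 1))) by (apply Rdiv_lt_0_compat; lra).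
  destruct (uniform_continuity_2d (fun x t => k (clamp x) (clamp t)) 0 1 0 1)
    with (eps := mkposreal _ He) as [d Hd].
  { intros u v _ _ e.
    destruct (continuous_square_eps k Hk (clamp u) (clamp v) (clamp_I01 u)
      (clamp_I01 v) e (cond_pos e)) as [d [Hd H1]].
    exists (mkposreal d Hd). intros u' v' Hu Hv.
    apply H1; try apply clamp_I01; (eapply Rle_lt_trans; [apply clamp_contracting|easy]). }
  exists d; split; [apply cond_pos|]. intros x' Hx' Hxx.
  apply Rle_lt_trans with (eps / 2); [|lra].
  apply RInt_I01_diff_le; try now apply continuous_on_kernel.
  intros t Ht.
  assert (H := Hd x t x' t Hx Ht Hx' Ht Hxx).
  rewrite Rminus_diag, Rabs_R0 in H. specialize (H (cond_pos d)).
  simpl in H. rewrite !clamp_id in H by assumption.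
  replace (k x' t * y t - k x t * y t) with ((k x' t - k x t) * y t) by ring.
  rewrite Rabs_mult.
  replace (eps / 2) with (eps / (2 * (C + 1)) * (C + 1)) by (field; lra).
  apply Rmult_le_compat; try apply Rabs_pos; [lra|].
  specialize (HyC t Ht). lra.
Qed.

(** * Differentiation on the closed interval *)

Lemma D_in_interior g d x : 0 < x < 1 -> D_in g d I01 x -> is_derive g x (d x).
Proof.
  intros Hx H. apply is_derive_Reals. intros eps Heps.
  destruct (H eps Heps) as [a [Ha H1]].
  assert (Hr : 0 < Rmin a (Rmin x (1 - x))) by (repeat apply Rmin_glb_lt; lra).
  exists (mkposreal _ Hr). simpl. intros h Hh0 Hh.
  assert (Rabs h < a /\ Rabs h < x /\ Rabs h < 1 - x) as (A1 & A2 & A3).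
  { revert Hh. unfold Rmin; repeat destruct Rle_dec; lra. }
  assert (Hb : -Rabs h <= h <= Rabs h) by (unfold Rabs; destruct Rcase_abs; lra).
  specialize (H1 (x + h)). simpl in H1. unfold Rdist in H1.
  replace (x + h - x) with h in H1 by ring. apply H1.
  split; [split; [unfold I01; lra|]|easy].
  intro. apply Hh0. lra.
Qed.

Lemma D_in_continuous g d : (forall x, I01 x -> D_in g d I01 x) ->
  continuous_on I01 g.
Proof.
  intros H. apply continuous_on_I01_eps. intros x Hx eps Heps.
  assert (Hc := cont_deriv g d I01 x (H x Hx)).
  destruct (Hc eps Heps) as [a [Ha H1]]. exists a; split; [easy|].
  intros y Hy Hyx. destruct (Req_dec y x) as [->|Hne].
  - now rewrite Rminus_diag, Rabs_R0.
  - apply (H1 y). split; [|exact Hyx]. split; [exact Hy|now apply not_eq_sym].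
Qed.

Lemma is_Cn_continuous n y d i : is_Cn n y d -> (i <= n)%nat ->
  continuous_on I01 (d i).
Proof.
  intros (_ & HD & Hc) Hi. destruct (Nat.eq_dec i n) as [->|Hne]; [easy|].
  apply D_in_continuous with (d (S i)). intros x Hx. apply HD; [lia|easy].
Qed.

Lemma is_Cn_continuous_fun n y d : is_Cn n y d -> continuous_on I01 y.
Proof.
  intros H. apply continuous_on_ext with (d 0%nat); [apply H|].
  apply (is_Cn_continuous n y); [easy|lia].
Qed.

Lemma is_Cn_derive n y d i x : is_Cn n y d -> (i < n)%nat -> 0 < x < 1 ->
  is_derive (d i) x (d (S i) x).
Proof.
  intros (_ & HD & _) Hi Hx. apply D_in_interior; [easy|].
  apply HD; [easy|unfold I01; lra].
Qed.

Lemma is_Cn_lincomb n a b y z d e : is_Cn n y d -> is_Cn n z e ->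
  is_Cn n (fun x => a * y x + b * z x) (fun i x => a * d i x + b * e i x).
Proof.
  intros (Hy & HD & Hc) (Hz & HE & Hc'). split; [|split].
  - intros x Hx. now rewrite Hy, Hz.
  - intros i x Hi Hx.
    assert (Hs : forall c g g', D_in g g' I01 x ->
      D_in (fun t => c * g t) (fun t => c * g' t) I01 x).
    { intros c g g' Hg. exact (Dmult_const I01 g g' x c Hg). }
    apply (Dadd I01 (fun t => a * d (S i) t) (fun t => b * e (S i) t)
      (fun t => a * d i t) (fun t => b * e i t)); apply Hs; auto.
  - now apply continuous_on_lincomb.
Qed.

Lemma mean_value_I01 (g g' : R -> R) a b : continuous_on I01 g ->
  (forall x, 0 < x < 1 -> is_derive g x (g' x)) -> I01 a -> I01 b -> a < b ->
  exists c, a < c < b /\ g b - g a = g' c * (b - a).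
Proof.
  intros Hc Hd Ha Hb Hab. unfold I01 in *.
  assert (HD : forall x, 0 < x < 1 -> is_derive (fun t => g (clamp t)) x (g' x)).
  { intros x Hx. apply is_derive_ext_loc with g; [|now apply Hd].
    assert (Hr : 0 < Rmin x (1 - x)) by (apply Rmin_glb_lt; lra).
    exists (mkposreal _ Hr). intros t Ht.
    change (Rabs (t - x) < Rmin x (1 - x)) in Ht.
    rewrite clamp_id; [easy|]. unfold I01.
    revert Ht. unfold Rmin; destruct Rle_dec; unfold Rabs; destruct Rcase_abs; lra. }
  assert (HD' : forall c, a < c < b -> derivable_pt (fun t => g (clamp t)) c).
  { intros c Hcab. exists (g' c). apply is_derive_Reals, HD. lra. }
  destruct (MVT (fun t => g (clamp t)) id a b HD' (fun c _ => derivable_pt_id c) Hab)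
    as [c [P H]].
  - intros c _. now apply continuity_clamp.
  - intros c _. apply derivable_continuous_pt, derivable_pt_id.
  - exists c. split; [exact P|].
    rewrite derive_pt_id, !clamp_id in H by (unfold I01; lra).
    rewrite (derive_pt_eq_0 _ _ (g' c)) in H by (apply is_derive_Reals, HD; lra).
    unfold id in H. lra.
Qed.

(** * The characteristic equation *)

Lemma cosh_pos a : 0 < cosh a.
Proof. unfold cosh. assert (H := exp_pos a). assert (H' := exp_pos (- a)). lra. Qed.

Lemma sinh_pos a : 0 < a -> 0 < sinh a.
Proof. intros H. rewrite <- sinh_0. now apply sinh_lt. Qed.

Lemma sinh_nonneg a : 0 <= a -> 0 <= sinh a.
Proof. intros [H| <-]; [now apply Rlt_le, sinh_pos|rewrite sinh_0; lra]. Qed.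

Lemma cosh_sqr a : cosh a * cosh a = 1 + sinh a * sinh a.
Proof.
  unfold cosh, sinh.
  assert (H : exp a * exp (- a) = 1) by (rewrite <- exp_plus, Rplus_opp_r; apply exp_0).
  nra.
Qed.

(** cos a * cosh a times tan a + tanh a: unlike the latter it is continuous
    across the poles of tan. *)
Definition tan_tanh_gap (a : R) : R := sin a * cosh a + cos a * sinh a.

Lemma tan_tanh_gap_zero z : 0 < z -> tan_tanh_gap z = 0 -> tan_tanh_root z.
Proof.
  unfold tan_tanh_gap. intros Hz H.
  assert (Hc : cos z <> 0).
  { intros E. rewrite E in H.
    assert (Hs : sin z * cosh z = 0) by lra.
    apply Rmult_integral in Hs. assert (H1 := cosh_pos z).
    destruct Hs as [Hs|Hs]; [|lra].
    assert (H2 := sin2_cos2 z). unfold Rsqr in H2. rewrite E, Hs in H2. lra. }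
  split; [easy|split; [easy|]].
  assert (H1 := cosh_pos z). unfold tan, tanh.
  apply Rmult_eq_reg_r with (cos z * cosh z); [field_simplify; lra|nra].
Qed.

(** The gap is positive at PI/2, so a value <= 0 at b forces a sign change
    before b. *)
Lemma tan_tanh_root_below b : PI / 2 <= b -> tan_tanh_gap b <= 0 ->
  exists z, z <= b /\ tan_tanh_root z.
Proof.
  intros Hb H. assert (HP := PI_RGT_0).
  destruct H as [H|H].
  2: { exists b; split; [lra|]. apply tan_tanh_gap_zero; [lra|easy]. }
  assert (H0 : 0 < tan_tanh_gap (PI / 2)).
  { unfold tan_tanh_gap. rewrite sin_PI2, cos_PI2. assert (H1 := cosh_pos (PI / 2)). lra. }
  destruct Hb as [Hb| <-]; [|lra].
  destruct (IVT (fun a => - tan_tanh_gap a) (PI / 2) b) as [z [Hz Hg]]; try lra.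
  - intros x. unfold tan_tanh_gap. apply derivable_continuous_pt. apply ex_derive_Reals_0.
    unfold cosh, sinh. auto_derive. easy.
  - exists z; split; [lra|]. apply tan_tanh_gap_zero; lra.
Qed.

(** Since k1 is the first root, the gap cannot have changed sign up to m < k1;
    and k1 <= PI because the gap is negative at PI. *)
Lemma frequency_bounds c1 m : is_c1 c1 -> 0 < m -> 4 * m ^ 4 < c1 ->
  m < PI /\ 0 < tan_tanh_gap m.
Proof.
  intros (k1 & (Hk1 & _) & Hmin & ->) Hm Hlt. assert (HP := PI_RGT_0).
  assert (Hmk : m < k1).
  { apply Rnot_le_lt. intros H. assert (H1 := pow_incr k1 m 4 (conj (Rlt_le _ _ Hk1) H)). lra. }
  split.
  - destruct (tan_tanh_root_below PI) as [z [Hz Hr]]; [lra| |].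
    + unfold tan_tanh_gap. rewrite sin_PI, cos_PI. assert (H := sinh_pos PI HP). lra.
    + apply Hmin in Hr. lra.
  - apply Rnot_le_lt. intros H.
    destruct (Rle_lt_dec (PI / 2) m) as [Hm2|Hm2].
    + destruct (tan_tanh_root_below m Hm2 H) as [z [Hz Hr]]. apply Hmin in Hr. lra.
    + revert H. apply Rlt_not_le. unfold tan_tanh_gap.
      apply Rplus_lt_0_compat; apply Rmult_lt_0_compat.
      * apply sin_gt_0; lra.
      * apply cosh_pos.
      * apply cos_gt_0; lra.
      * now apply sinh_pos.
Qed.

Lemma nonneg_of_derive (g g' : R -> R) a : (forall x, is_derive g x (g' x)) -> g 0 = 0 ->
  (forall x, 0 <= x <= a -> 0 <= g' x) -> 0 <= a -> 0 <= g a.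
Proof.
  intros Hd H0 Hg [Ha| <-]; [|lra].
  destruct (MVT_cor2 g g' 0 a Ha) as [c [H1 H2]].
  - intros; apply is_derive_Reals, Hd.
  - assert (0 <= g' c) by (apply Hg; lra). nra.
Qed.

Lemma sin_cos_le_sinh_cosh a : 0 <= a -> sin a * cos a <= sinh a * cosh a.
Proof.
  intros Ha.
  enough (0 <= sinh a * cosh a - sin a * cos a) by lra.
  apply (nonneg_of_derive (fun x => sinh x * cosh x - sin x * cos x)
    (fun x => 2 * (sinh x * sinh x) + 2 * (sin x * sin x))); [| |intros; nra|easy].
  - intros x. unfold sinh, cosh. auto_derive; [easy|].
    assert (H : exp x * exp (- x) = 1) by (rewrite <- exp_plus, Rplus_opp_r; apply exp_0).
    assert (H1 := sin2_cos2 x). unfold Rsqr in H1.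
    nra.
  - rewrite sinh_0, sin_0. ring.
Qed.

Lemma sinh_cos_le_sin_cosh a : 0 <= a -> a <= PI / 2 ->
  sinh a * cos a <= sin a * cosh a.
Proof.
  intros Ha Ha2. assert (HP := PI_RGT_0).
  enough (0 <= sin a * cosh a - sinh a * cos a) by lra.
  apply (nonneg_of_derive (fun x => sin x * cosh x - sinh x * cos x)
    (fun x => 2 * (sin x * sinh x))); [| | |easy].
  - intros x. unfold sinh, cosh. auto_derive; [easy|]. field.
  - rewrite sinh_0, sin_0. ring.
  - intros x Hx. assert (0 <= sin x) by (apply sin_ge_0; lra).
    assert (0 <= sinh x) by (apply sinh_nonneg; lra). nra.
Qed.

(** This is tanh m / tan m <= tanh a / tan a, cleared of its denominators so that
    it makes sense when a = 0 or cos a = 0 or cos m = 0.  The derivative of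
    tanh/tan has the sign of sin * cos - sinh * cosh. *)
Lemma tanh_over_tan_decreasing a m : 0 <= a -> a <= m -> m < PI ->
  0 <= (cosh m * sin m) * (sinh a * cos a) - (sinh m * cos m) * (cosh a * sin a).
Proof.
  intros [Ha| <-] Ham Hm.
  2: { rewrite sinh_0, sin_0. lra. }
  destruct Ham as [Ham|<-]; [|lra].
  assert (Hpos : forall x, 0 < x < PI -> 0 < cosh x * sin x).
  { intros x Hx. apply Rmult_lt_0_compat; [apply cosh_pos|apply sin_gt_0; lra]. }
  set (r := fun x => (sinh x * cos x) / (cosh x * sin x)).
  set (r' := fun x => (sin x * cos x - sinh x * cosh x) / (cosh x * sin x) ^ 2).
  destruct (MVT_cor2 r r' a m Ham) as [c [H1 H2]].
  { intros c Hc. apply is_derive_Reals. assert (Hp := Hpos c ltac:(lra)).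
    replace (r' c) with (((cosh c * cos c - sinh c * sin c) * (cosh c * sin c)
      - (sinh c * cos c) * (sinh c * sin c + cosh c * cos c)) / (cosh c * sin c) ^ 2).
    2: { unfold r'. apply (f_equal (fun z => z / (cosh c * sin c) ^ 2)).
      assert (Hsc := sin2_cos2 c). unfold Rsqr in Hsc. assert (Hch := cosh_sqr c).
      transitivity (sin c * cos c * (cosh c * cosh c - sinh c * sinh c)
        - sinh c * cosh c * (sin c * sin c + cos c * cos c)); [ring|].
      rewrite Hsc, Hch. ring. }
    apply (is_derive_div (fun x => sinh x * cos x) (fun x => cosh x * sin x) c
      (cosh c * cos c - sinh c * sin c) (sinh c * sin c + cosh c * cos c)); [| |lra]; unfold sinh, cosh; (auto_derive; [easy|]); field. }
  assert (Hr : r m <= r a).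
  { enough (r' c <= 0) by nra. unfold r'.
    assert (Hp := Hpos c ltac:(lra)).
    assert (H3 := sin_cos_le_sinh_cosh c ltac:(lra)).
    apply Rmult_le_reg_r with ((cosh c * sin c) ^ 2); [nra|].
    field_simplify; [lra|]. split; nra. }
  assert (Pa := Hpos a ltac:(lra)). assert (Pm := Hpos m ltac:(lra)).
  unfold r in Hr.
  apply (Rmult_le_compat_r (cosh m * sin m * (cosh a * sin a))) in Hr; [|nra].
  field_simplify in Hr; nra.
Qed.

(** * The beam profile *)

(** The function h of the proof and its first three derivatives.  Up to a factor,
    h is the even solution of h'''' + 4 m^4 h = 0 with h'(1) = 0; the factor is
    chosen so that h' has the simplest coefficients.  Reflected oddly at both
    ends, h (1 - |x - s|) becomes the Green function of the simply supported
    beam. *)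
Definition profile (m : R) (i : nat) (t : R) : R :=
  let a := m * t in
  let p := cosh m * sin m in
  let q := sinh m * cos m in
  match i with
  | 0%nat => (p * (sinh a * sin a + cosh a * cos a)
             + q * (cosh a * cos a - sinh a * sin a)) / (2 * m)
  | 1%nat => p * (sinh a * cos a) - q * (cosh a * sin a)
  | 2%nat => m * (p * (cosh a * cos a - sinh a * sin a)
                  - q * (sinh a * sin a + cosh a * cos a))
  | _ => - 2 * m ^ 2 * (p * (cosh a * sin a) + q * (sinh a * cos a))
  end.

Lemma profile_derive m i t : 0 < m -> (i < 3)%nat ->
  is_derive (profile m i) t (profile m (S i) t).
Proof.
  intros Hm Hi. unfold profile.
  destruct i as [|[|[|i]]]; [| | |lia]; cbv beta iota zeta;
    unfold sinh, cosh; (auto_derive; [try easy; lra|]); field; lra.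
Qed.

Lemma profile_ode m t : 0 < m ->
  is_derive (profile m 3) t (- (4 * m ^ 4) * profile m 0 t).
Proof.
  intros Hm. unfold profile.
  cbv beta iota zeta; unfold sinh, cosh; (auto_derive; [easy|]); field; lra.
Qed.

Lemma sinh_opp a : sinh (- a) = - sinh a.
Proof. unfold sinh. rewrite Ropp_involutive. field. Qed.

Lemma cosh_opp a : cosh (- a) = cosh a.
Proof. unfold cosh. rewrite Ropp_involutive. field. Qed.

Lemma profile_even m i t : i = 0%nat \/ i = 2%nat -> profile m i (- t) = profile m i t.
Proof.
  unfold profile. rewrite Ropp_mult_distr_r_reverse, sinh_opp, cosh_opp, sin_neg, cos_neg.
  intros [-> | ->]; unfold Rdiv; ring.
Qed.

Lemma profile_odd m i t : i = 1%nat \/ i = 3%nat -> profile m i (- t) = - profile m i t.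
Proof.
  unfold profile. rewrite Ropp_mult_distr_r_reverse, sinh_opp, cosh_opp, sin_neg, cos_neg.
  intros [-> | ->]; ring.
Qed.

Lemma profile1_at_1 m : profile m 1 1 = 0.
Proof. unfold profile. rewrite Rmult_1_r. ring. Qed.

Lemma profile1_nonneg m t : 0 < m < PI -> I01 t -> 0 <= profile m 1 t.
Proof. intros Hm [H0 H1]. apply tanh_over_tan_decreasing; nra. Qed.

(** Only sinh m * cos m or sinh a * cos a can be negative here.  If cos m >= 0,
    then a <= m <= PI/2 and no term is negative.  If cos m and cos a are both
    negative, their product is positive.  In the remaining case the positivity
    of the gap at m bounds - sinh m * cos m by cosh m * sin m, while
    sinh a * cos a <= cosh a * sin a because tanh <= tan on [0, PI/2). *)
Lemma profile3_nonpos m t : 0 < m < PI -> 0 < tan_tanh_gap m -> I01 t ->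
  profile m 3 t <= 0.
Proof.
  intros Hm Hg [H0 H1]. unfold profile. cbv zeta.
  set (a := m * t).
  assert (Ha : 0 <= a <= m) by (unfold a; nra).
  assert (Hsm : 0 < sin m) by (apply sin_gt_0; lra).
  assert (Hsa : 0 <= sin a) by (apply sin_ge_0; lra).
  assert (Cm := cosh_pos m). assert (Ca := cosh_pos a).
  assert (Sm : 0 < sinh m) by (apply sinh_pos; lra).
  assert (Sa : 0 <= sinh a) by (apply sinh_nonneg; lra).
  assert (Hp : 0 < cosh m * sin m) by nra.
  enough (0 <= cosh m * sin m * (cosh a * sin a) + sinh m * cos m * (sinh a * cos a)).
  { assert (0 < m ^ 2) by nra.
    assert (0 <= m ^ 2 * (cosh m * sin m * (cosh a * sin a) + sinh m * cos m * (sinh a * cos a)))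
      by (apply Rmult_le_pos; lra).
    lra. }
  assert (HX : 0 <= cosh a * sin a) by nra.
  destruct (Rle_lt_dec 0 (cos m)) as [Hcm|Hcm].
  - assert (Hm2 : m <= PI / 2).
    { apply Rnot_lt_le. intros H. assert (cos m < 0) by (apply cos_lt_0; lra). lra. }
    assert (0 <= cos a) by (apply cos_ge_0; lra).
    assert (0 <= cosh m * sin m * (cosh a * sin a)) by (apply Rmult_le_pos; lra).
    assert (0 <= sinh m * cos m) by (apply Rmult_le_pos; lra).
    assert (0 <= sinh a * cos a) by (apply Rmult_le_pos; lra).
    assert (0 <= sinh m * cos m * (sinh a * cos a)) by (apply Rmult_le_pos; lra).
    lra.
  - destruct (Rle_lt_dec 0 (cos a)) as [Hca|Hca].
    + assert (Ha2 : a <= PI / 2).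
      { apply Rnot_lt_le. intros H. assert (cos a < 0) by (apply cos_lt_0; lra). lra. }
      assert (Hta := sinh_cos_le_sin_cosh a ltac:(lra) Ha2).
      unfold tan_tanh_gap in Hg.
      assert (Hz : 0 <= sinh a * cos a) by (apply Rmult_le_pos; lra).
      assert (Hneg : 0 <= sinh m * - cos m) by (apply Rmult_le_pos; lra).
      assert (sinh m * - cos m * (sinh a * cos a) <= cosh m * sin m * (cosh a * sin a))
        by (apply Rmult_le_compat; lra).
      lra.
    + assert (0 <= (sinh m * - cos m) * (sinh a * - cos a))
        by (apply Rmult_le_pos; apply Rmult_le_pos; lra).
      assert (0 <= cosh m * sin m * (cosh a * sin a)) by (apply Rmult_le_pos; lra).
      nra.
Qed.

(** Twice the modulus of this value is the jump of the third derivative of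
    h (1 - |x - s|) at s = x, which makes the Green function normalisation
    positive. *)
Lemma profile3_at_1 m : 0 < m < PI -> profile m 3 1 < 0.
Proof.
  intros Hm. unfold profile. rewrite Rmult_1_r.
  assert (Hsm : 0 < sin m) by (apply sin_gt_0; lra).
  assert (Cm := cosh_pos m).
  assert (Hp : 0 < cosh m * sin m) by nra.
  assert (0 < m ^ 2) by nra.
  assert (0 < cosh m * sin m * (cosh m * sin m) + sinh m * cos m * (sinh m * cos m)) by nra.
  nra.
Qed.

Lemma profile0_increasing m a b : 0 < m < PI -> 0 <= a -> a <= b -> b <= 1 ->
  profile m 0 a <= profile m 0 b.
Proof.
  intros Hm Ha [Hab| <-] Hb; [|lra].
  destruct (MVT_cor2 (profile m 0) (profile m 1) a b Hab) as [c [H1 H2]].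
  - intros c _. apply is_derive_Reals, profile_derive; [lra|lia].
  - assert (0 <= profile m 1 c) by (apply profile1_nonneg; [lra|unfold I01; lra]). nra.
Qed.

Lemma profile0_abs m t : profile m 0 (Rabs t) = profile m 0 t.
Proof. unfold Rabs. destruct Rcase_abs; [apply profile_even; tauto|easy]. Qed.

Lemma profile0_le m a b : 0 < m < PI -> Rabs a <= Rabs b <= 1 ->
  profile m 0 a <= profile m 0 b.
Proof.
  intros Hm H. rewrite <- (profile0_abs m a), <- (profile0_abs m b).
  apply profile0_increasing; try easy. apply Rabs_pos.
Qed.

(** * The maximum principle *)

(** The boundary terms of integrating phi y'''' - phi'''' y by parts, with
    phi i and d i the i-th derivatives of phi and y. *)
Definition lagrange (phi d : nat -> R -> R) (s : R) : R :=
  phi 0%nat s * d 3%nat s - phi 1%nat s * d 2%nat s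
  + phi 2%nat s * d 1%nat s - phi 3%nat s * d 0%nat s.

(** When phi'''' = - M phi, the derivative of the form is phi (y'''' + M y). *)
Lemma lagrange_le M phi y d a b : is_Cn 4 y d ->
  (forall i s, (i < 3)%nat -> is_derive (phi i) s (phi (S i) s)) ->
  (forall s, is_derive (phi 3%nat) s (- M * phi 0%nat s)) ->
  (forall s, 0 < s < 1 -> 0 <= d 4%nat s + M * y s) ->
  (forall s, a <= s <= b -> 0 <= phi 0%nat s) ->
  0 <= a -> a < b -> b <= 1 -> lagrange phi d a <= lagrange phi d b.
Proof.
  intros Hy Hphi Hphi3 Hq Hpos Ha Hab Hb.
  assert (Cphi : forall i, (i <= 3)%nat -> continuous_on I01 (phi i)).
  { intros i Hi s Hs. apply filterlim_within_ext with (phi i); [easy|].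
    assert (Hex : ex_derive (phi i) s).
    { destruct (Nat.eq_dec i 3) as [->|]; [eexists; apply Hphi3|].
      eexists; apply Hphi; lia. }
    apply filterlim_filter_le_1 with (2 := ex_derive_continuous _ _ Hex).
    apply filter_le_within. }
  destruct (mean_value_I01 (lagrange phi d)
    (fun s => phi 0%nat s * (d 4%nat s + M * d 0%nat s)) a b) as [c [Hc He]].
  - assert (Cd := fun i => is_Cn_continuous 4 y d i Hy).
    assert (Cpd : forall i j, (i <= 3)%nat -> (j <= 4)%nat ->
      continuous_on I01 (fun s => phi i s * d j s)).
    { intros. apply continuous_on_mult; auto. }
    apply continuous_on_ext with (fun s =>
      1 * (1 * (phi 0%nat s * d 3%nat s) + -1 * (phi 1%nat s * d 2%nat s))
      + 1 * (1 * (phi 2%nat s * d 1%nat s) + -1 * (phi 3%nat s * d 0%nat s))).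
    { intros s _. unfold lagrange. lra. }
    repeat apply continuous_on_lincomb; apply Cpd; lia.
  - intros s Hs. unfold lagrange.
    assert (D0 := is_Cn_derive 4 y d 0 s Hy ltac:(lia) Hs).
    assert (D1 := is_Cn_derive 4 y d 1 s Hy ltac:(lia) Hs).
    assert (D2 := is_Cn_derive 4 y d 2 s Hy ltac:(lia) Hs).
    assert (D3 := is_Cn_derive 4 y d 3 s Hy ltac:(lia) Hs).
    assert (P0 := Hphi 0%nat s ltac:(lia)). assert (P1 := Hphi 1%nat s ltac:(lia)).
    assert (P2 := Hphi 2%nat s ltac:(lia)). assert (P3 := Hphi3 s).
    auto_derive.
    + repeat split; eexists; eassumption.
    + repeat match goal with
        |- context [Derive ?g s] => erewrite (is_derive_unique g s) by eassumption
      end.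
      ring.
  - unfold I01; lra.
  - unfold I01; lra.
  - easy.
  - destruct Hy as [Hy _]. rewrite Hy in He by (unfold I01; lra).
    assert (H1 := Hpos c ltac:(lra)). assert (H2 := Hq c ltac:(lra)).
    assert (H3 := Rmult_le_pos _ _ H1 H2). nra.
Qed.

(** The case N = 0 is the principle for the local operator y'''' + M y. *)
Definition inverse_positive (M N : R) (k : R -> R -> R) : Prop :=
  forall y d, is_Cn 4 y d -> (forall x, 0 < x < 1 -> 0 <= Lop M N k y d x) ->
    0 <= y 0 -> 0 <= y 1 -> d 2%nat 0 <= 0 -> d 2%nat 1 <= 0 ->
    forall x, I01 x -> 0 <= y x.

Lemma is_derive_shift (g g' : R -> R) c s : (forall t, is_derive g t (g' t)) ->
  is_derive (fun s => g (s + c)) s (g' (s + c)).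
Proof.
  intros H. rewrite <- (Rmult_1_l (g' (s + c))).
  apply (is_derive_comp g (fun s => s + c) s (g' (s + c)) 1); [apply H|].
  auto_derive; [easy|ring].
Qed.

(** For x in (0,1) the test function is, up to a positive factor, s |-> G(x,s).
    Its Lagrange form with y increases on [0,x] and on [x,1].  At s = x the
    branches agree except for the jump of the third derivative, which
    contributes - 2 h'''(1) y(x); at s = 0 and s = 1 only the terms with
    y'', y and with h' and h''' survive, and they have favourable signs.  Adding
    the two comparisons gives y(x) >= 0. *)
Lemma beam_inverse_positive M c1 k : 0 < M -> is_c1 c1 -> M < c1 ->
  inverse_positive M 0 k.
Proof.
  intros HM Hc1 HMc y d Hy Hq Hy0 Hy1 Hd0 Hd1 x [Hx0 Hx1].
  destruct Hx0 as [Hx0| <-]; [|easy]. destruct Hx1 as [Hx1| ->]; [|easy].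
  set (m := sqrt (sqrt (M / 4))).
  assert (Hm : 0 < m) by (apply sqrt_lt_R0, sqrt_lt_R0; lra).
  assert (HmM : 4 * m ^ 4 = M).
  { replace (m ^ 4) with ((m * m) * (m * m)) by ring. unfold m.
    assert (H := sqrt_pos (M / 4)).
    rewrite !sqrt_sqrt; lra. }
  destruct (frequency_bounds c1 m Hc1 Hm) as [HmPI Hgap]; [lra|].
  assert (Hm' : 0 < m < PI) by lra.
  (* The branches s <= x and s >= x of G(x,.) are given by c = 1 - x and by
     c = - x - 1: h is even, so h (1 + x - s) = h (s - x - 1), and no sign
     appears when differentiating in s. *)
  set (phi := fun c i s => profile m i (s + c) - profile m i (s + (x - 1))).
  assert (Hphi : forall c i s, (i < 3)%nat -> is_derive (phi c i) s (phi c (S i) s)).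
  { intros c i s Hi.
    apply (is_derive_minus (V := R_NormedModule)); apply is_derive_shift;
      intros; now apply profile_derive. }
  assert (Hphi3 : forall c s, is_derive (phi c 3%nat) s (- M * phi c 0%nat s)).
  { intros c s. rewrite <- HmM. unfold phi. rewrite Rmult_minus_distr_l.
    apply (is_derive_minus (V := R_NormedModule));
      apply (is_derive_shift _ (fun t => - (4 * m ^ 4) * profile m 0 t));
      intros; now apply profile_ode. }
  assert (Hq' : forall s, 0 < s < 1 -> 0 <= d 4%nat s + M * y s).
  { intros s Hs. specialize (Hq s Hs). unfold Lop in Hq. lra. }
  assert (W1 : lagrange (phi (1 - x)) d 0 <= lagrange (phi (1 - x)) d x).
  { apply (lagrange_le M _ y); auto; [|lra..].
    intros s Hs. apply Rge_le, Rge_minus, Rle_ge, profile0_le; [easy|].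
    unfold Rabs; repeat destruct Rcase_abs; lra. }
  assert (W2 : lagrange (phi (- x - 1)) d x <= lagrange (phi (- x - 1)) d 1).
  { apply (lagrange_le M _ y); auto; [|lra..].
    intros s Hs. apply Rge_le, Rge_minus, Rle_ge, profile0_le; [easy|].
    unfold Rabs; repeat destruct Rcase_abs; lra. }
  destruct Hy as [Ey _].
  rewrite <- !Ey in * by (unfold I01; lra).
  unfold lagrange, phi in W1, W2.
  replace (0 + (1 - x)) with (1 - x) in W1 by ring.
  replace (0 + (x - 1)) with (- (1 - x)) in W1 by ring.
  replace (x + (1 - x)) with 1 in W1 by ring.
  replace (x + (- x - 1)) with (- (1)) in W2 by ring.
  replace (1 + (- x - 1)) with (- x) in W2 by ring.
  replace (1 + (x - 1)) with x in W2 by ring.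
  rewrite (profile_even m 0 (1 - x)), (profile_even m 2 (1 - x)),
    (profile_odd m 1 (1 - x)), (profile_odd m 3 (1 - x)) in W1 by tauto.
  rewrite (profile_even m 0 1), (profile_even m 2 1), (profile_odd m 1 1),
    (profile_odd m 3 1), (profile_even m 0 x), (profile_even m 2 x),
    (profile_odd m 1 x), (profile_odd m 3 x) in W2 by tauto.
  rewrite profile1_at_1 in W1, W2.
  assert (H3 := profile3_at_1 m Hm').
  assert (A1 := profile1_nonneg m (1 - x) Hm' ltac:(unfold I01; lra)).
  assert (A2 := profile1_nonneg m x Hm' ltac:(unfold I01; lra)).
  assert (A3 := profile3_nonpos m (1 - x) Hm' Hgap ltac:(unfold I01; lra)).
  assert (A4 := profile3_nonpos m x Hm' Hgap ltac:(unfold I01; lra)).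
  enough (0 <= - profile m 3 1 * d 0%nat x) by nra.
  assert (B1 : 0 <= profile m 1 (1 - x) * - d 2%nat 0) by (apply Rmult_le_pos; lra).
  assert (B2 : 0 <= profile m 1 x * - d 2%nat 1) by (apply Rmult_le_pos; lra).
  assert (B3 : 0 <= - profile m 3 (1 - x) * d 0%nat 0) by (apply Rmult_le_pos; lra).
  assert (B4 : 0 <= - profile m 3 x * d 0%nat 1) by (apply Rmult_le_pos; lra).
  lra.
Qed.

Lemma Kint_ge_of_bound k knorm y mu x : continuous_square k ->
  (forall x t, I01 x -> I01 t -> 0 <= k x t <= knorm) -> 0 <= mu ->
  continuous_on I01 y -> (forall t, I01 t -> - mu <= y t) -> I01 x ->
  - (knorm * mu) <= Kint k y x.
Proof.
  intros Hk Hkn Hmu Hy Hlow Hx.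
  replace (- (knorm * mu)) with (RInt (fun _ => - (knorm * mu)) 0 1)
    by (rewrite RInt_const; unfold scal; simpl; unfold mult; simpl; ring).
  apply RInt_I01_mono; [apply continuous_on_const|now apply continuous_on_kernel|].
  intros t Ht. destruct (Hkn x t Hx Ht) as [K0 K1]. specialize (Hlow t Ht).
  assert (k x t * - mu <= k x t * y t) by (apply Rmult_le_compat_l; lra).
  assert (k x t * mu <= knorm * mu) by (apply Rmult_le_compat_r; lra). lra.
Qed.

(** If y had minimum - mu < 0, then N K y >= - N knorm mu, so that
    y + N knorm mu e satisfies the hypotheses of the principle for N = 0, where
    e solves e'''' + M e = 1; this gives mu <= N knorm mu gmax < mu. *)
Lemma nonlocal_inverse_positive M N k knorm G gmax : 0 <= N ->
  inverse_positive M 0 k -> continuous_square k ->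
  (forall x t, I01 x -> I01 t -> 0 <= k x t <= knorm) ->
  is_green M G -> (forall x, I01 x -> RInt (fun s => G x s) 0 1 <= gmax) ->
  N * knorm * gmax < 1 -> inverse_positive M N k.
Proof.
  intros HN Hloc Hk Hkn HG Hgmax Hsmall y d Hy Hq Hy0 Hy1 Hd0 Hd1.
  assert (Cy := is_Cn_continuous_fun 4 y d Hy).
  destruct (continuous_on_min y Cy) as [x0 [Hx0 Hmin]].
  intros x Hx. apply Rle_trans with (y x0); [|now apply Hmin].
  apply Rnot_lt_le. intros Hneg.
  set (mu := - y x0).
  destruct HG as [_ HG].
  set (E := fun x => RInt (fun s => G x s * 1) 0 1).
  assert (HE1 : linear_solution M (fun _ => 1) E) by (apply HG; apply continuous_on_const).
  destruct HE1 as [e (He & Hode & He0 & He1 & He20 & He21)].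
  assert (Hkn0 : 0 <= knorm) by (destruct (Hkn x x Hx Hx); lra).
  set (c := N * (knorm * mu)).
  assert (Hc : 0 <= c) by (unfold c, mu; repeat apply Rmult_le_pos; lra).
  assert (Hv := Hloc _ _ (is_Cn_lincomb 4 1 c y E d e Hy He)).
  assert (Hv0 : 0 <= 1 * y x0 + c * E x0).
  { apply Hv; [|cbv beta; rewrite ?He0, ?He1, ?He20, ?He21; lra..|easy].
    intros s Hs. specialize (Hq s Hs). specialize (Hode s Hs). unfold Lop in *.
    assert (HK : N * - (knorm * mu) <= N * Kint k y s).
    { apply Rmult_le_compat_l; [easy|].
      apply Kint_ge_of_bound; try easy; [unfold mu; lra| |unfold I01; lra].
      intros t Ht. unfold mu. specialize (Hmin t Ht). lra. }
    assert (Hc1 : c * (e 4%nat s + M * E s) = c) by (rewrite Hode; ring).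
    unfold c in *. lra. }
  assert (HE : E x0 <= gmax).
  { unfold E. rewrite (RInt_I01_ext _ (G x0)) by (intros; ring). now apply Hgmax. }
  assert (c * E x0 <= c * gmax) by now apply Rmult_le_compat_l.
  assert (c * gmax < mu).
  { replace (c * gmax) with (N * knorm * gmax * mu) by (unfold c; ring).
    unfold mu; nra. }
  unfold mu in *. lra.
Qed.

Lemma inverse_positive_compare M N k y d z e : continuous_square k ->
  inverse_positive M N k -> is_Cn 4 y d -> is_Cn 4 z e ->
  (forall x, 0 < x < 1 -> Lop M N k y d x <= Lop M N k z e x) ->
  y 0 <= z 0 -> y 1 <= z 1 -> e 2%nat 0 <= d 2%nat 0 -> e 2%nat 1 <= d 2%nat 1 ->
  forall x, I01 x -> y x <= z x.
Proof.
  intros Hk Hpos Hy Hz HL H0 H1 H20 H21 x Hx.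
  enough (0 <= 1 * z x + -1 * y x) by lra.
  apply (Hpos _ _ (is_Cn_lincomb 4 1 (-1) z y e d Hz Hy)); [|lra..|easy].
  intros s Hs. specialize (HL s Hs). unfold Lop in *.
  rewrite Kint_lincomb; [lra|easy| | |unfold I01; lra];
    eapply is_Cn_continuous_fun; eassumption.
Qed.

(** * Uniform convergence of monotone sequences *)

Definition monotone_seq (g : nat -> R -> R) : Prop :=
  (forall n x, I01 x -> g n x <= g (S n) x) \/
  (forall n x, I01 x -> g (S n) x <= g n x).

Definition pointwise_cv (g : nat -> R -> R) (l : R -> R) : Prop :=
  forall x, I01 x -> is_lim_seq (fun n => g n x) (l x).

Lemma monotone_seq_limit g l : monotone_seq g -> pointwise_cv g l ->
  (forall n x, I01 x -> g n x <= g (S n) x <= l x) \/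
  (forall n x, I01 x -> l x <= g (S n) x <= g n x).
Proof.
  intros [H|H] Hl; [left|right]; intros n x Hx; split; auto.
  - apply (is_lim_seq_incr_compare (fun n => g n x)); auto.
  - apply (is_lim_seq_decr_compare (fun n => g n x)); auto.
Qed.

(** The distance to the limit decreases with n, so if it is never uniformly
    below eps, there are points x_n at which it is at least eps for all indices up
    to n.  At a cluster point of the x_n this contradicts pointwise
    convergence. *)
Lemma dini g l : (forall n, continuous_on I01 (g n)) -> continuous_on I01 l ->
  monotone_seq g -> pointwise_cv g l -> unif_cv g l.
Proof.
  intros Hg Hl Hmono Hlim eps Heps.
  assert (Hstep : forall n m x, (n <= m)%nat -> I01 x ->
    Rabs (g m x - l x) <= Rabs (g n x - l x)).
  { intros n m x Hnm Hx. induction Hnm as [|m _ IH]; [lra|].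
    eapply Rle_trans; [|exact IH].
    destruct (monotone_seq_limit g l Hmono Hlim) as [H|H]; specialize (H m x Hx);
      unfold Rabs; repeat destruct Rcase_abs; lra. }
  destruct (classic (exists n, forall x, I01 x -> Rabs (g n x - l x) < eps))
    as [[n Hn]|Hno].
  { exists n. intros m x Hm Hx. eapply Rle_lt_trans; [now apply Hstep with (n := n)|auto]. }
  exfalso.
  assert (Hex : forall n, exists x, I01 x /\ eps <= Rabs (g n x - l x)).
  { intros n. apply NNPP. intros H. apply Hno. exists n. intros x Hx.
    apply Rnot_le_lt. intros He. apply H. now exists x. }
  set (xs := fun n => proj1_sig (constructive_indefinite_description _ (Hex n))).
  assert (Hxs : forall n, I01 (xs n) /\ eps <= Rabs (g n (xs n) - l (xs n))).
  { intros n. unfold xs. now destruct constructive_indefinite_description. }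
  destruct (Bolzano_Weierstrass xs I01 (compact_P3 0 1) (fun n => proj1 (Hxs n)))
    as [x Hadh].
  assert (Hx : I01 x).
  { split; apply Rnot_lt_le; intros Hout.
    - destruct (Hadh (disc x (mkposreal (- x) ltac:(lra))) 0%nat) as [p [_ Hp]].
      { now exists (mkposreal (- x) ltac:(lra)). }
      destruct (Hxs p) as [[H0 _] _]. unfold disc in Hp. simpl in Hp.
      revert Hp. unfold Rabs. destruct Rcase_abs; lra.
    - destruct (Hadh (disc x (mkposreal (x - 1) ltac:(lra))) 0%nat) as [p [_ Hp]].
      { now exists (mkposreal (x - 1) ltac:(lra)). }
      destruct (Hxs p) as [[_ H0] _]. unfold disc in Hp. simpl in Hp.
      revert Hp. unfold Rabs. destruct Rcase_abs; lra. }
  assert (Hlx := Hlim x Hx). apply is_lim_seq_spec in Hlx.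
  destruct (Hlx (mkposreal (eps / 2) ltac:(lra))) as [n Hn].
  specialize (Hn n (Nat.le_refl n)). simpl in Hn.
  assert (Hc : continuous_on I01 (fun t => 1 * g n t + -1 * l t))
    by now apply continuous_on_lincomb.
  rewrite continuous_on_I01_eps in Hc.
  destruct (Hc x Hx (eps / 2) ltac:(lra)) as [delta [Hdelta Hnear]].
  destruct (Hadh (disc x (mkposreal delta Hdelta)) n) as [p [Hp Hpx]].
  { now exists (mkposreal delta Hdelta). }
  destruct (Hxs p) as [Hp01 Hpe].
  specialize (Hnear (xs p) Hp01 Hpx). specialize (Hstep n p (xs p) Hp Hp01).
  revert Hn Hnear Hpe Hstep. unfold Rabs; repeat destruct Rcase_abs; lra.
Qed.

(** * A priori estimate *)

Lemma rolle_I01 g g' : continuous_on I01 g ->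
  (forall x, 0 < x < 1 -> is_derive g x (g' x)) -> g 0 = 0 -> g 1 = 0 ->
  exists c, 0 < c < 1 /\ g' c = 0.
Proof.
  intros Hc Hd H0 H1.
  destruct (mean_value_I01 g g' 0 1 Hc Hd) as [c [Hc1 Hc2]]; try (unfold I01; lra).
  exists c; split; [easy|lra].
Qed.

Lemma lipschitz_of_derive (g g' : R -> R) B : continuous_on I01 g ->
  (forall x, 0 < x < 1 -> is_derive g x (g' x)) ->
  (forall x, 0 < x < 1 -> Rabs (g' x) <= B) ->
  forall a b, I01 a -> I01 b -> Rabs (g b - g a) <= B * Rabs (b - a).
Proof.
  intros Hc Hd HB.
  assert (Hlt : forall a b, I01 a -> I01 b -> a < b -> Rabs (g b - g a) <= B * Rabs (b - a)).
  { intros a b Ha Hb Hab.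
    destruct (mean_value_I01 g g' a b Hc Hd Ha Hb Hab) as [c [Hcab ->]].
    rewrite Rabs_mult. apply Rmult_le_compat_r; [apply Rabs_pos|].
    apply HB. unfold I01 in *. lra. }
  intros a b Ha Hb. destruct (Rtotal_order a b) as [H|[ <- |H]].
  - now apply Hlt.
  - rewrite !Rminus_diag, Rabs_R0. lra.
  - rewrite (Rabs_minus_sym (g b)), (Rabs_minus_sym b). now apply Hlt.
Qed.

Lemma bounded_of_derive (g g' : R -> R) B c : continuous_on I01 g ->
  (forall x, 0 < x < 1 -> is_derive g x (g' x)) ->
  (forall x, 0 < x < 1 -> Rabs (g' x) <= B) -> I01 c -> g c = 0 ->
  forall x, I01 x -> Rabs (g x) <= B.
Proof.
  intros Hc Hd HB Hc01 Hgc x Hx.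
  assert (H := lipschitz_of_derive g g' B Hc Hd HB c x Hc01 Hx).
  rewrite Hgc, Rminus_0_r in H.
  assert (0 <= B) by (eapply Rle_trans; [apply Rabs_pos|apply (HB (1 / 2)); lra]).
  assert (Rabs (x - c) <= 1) by (unfold I01 in *; unfold Rabs; destruct Rcase_abs; lra).
  assert (B * Rabs (x - c) <= B * 1) by now apply Rmult_le_compat_l.
  lra.
Qed.

(** By Rolle, y''' vanishes between the zeros 0 and 1 of y'', and y' between those
    of y; so the bound B descends from y'''' to y''', y'' and y', each of which
    has a zero in an interval of length 1. *)
Lemma navier_lipschitz y d B : is_Cn 4 y d -> navier y d ->
  (forall x, 0 < x < 1 -> Rabs (d 4%nat x) <= B) ->
  forall a b, I01 a -> I01 b -> Rabs (y b - y a) <= B * Rabs (b - a).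
Proof.
  intros Hy (Hy0 & Hy1 & H20 & H21) HB.
  assert (Hi : forall x, 0 < x < 1 -> I01 x) by (unfold I01; intros; lra).
  assert (Cd : forall i, (i <= 4)%nat -> continuous_on I01 (d i))
    by (intros; now apply (is_Cn_continuous 4 y)).
  assert (Dd : forall i, (i < 4)%nat -> forall x, 0 < x < 1 -> is_derive (d i) x (d (S i) x))
    by (intros; now apply (is_Cn_derive 4 y)).
  assert (E0 : forall x, I01 x -> d 0%nat x = y x) by apply Hy.
  assert (I0 : I01 0) by (unfold I01; lra). assert (I1 : I01 1) by (unfold I01; lra).
  destruct (rolle_I01 (d 2%nat) (d 3%nat)) as [c [Hc Hc3]];
    [apply Cd; lia|apply Dd; lia|easy|easy|].
  assert (B3 := bounded_of_derive (d 3%nat) (d 4%nat) B c (Cd 3%nat ltac:(lia))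
    (Dd 3%nat ltac:(lia)) HB (Hi c Hc) Hc3).
  assert (B2 := bounded_of_derive (d 2%nat) (d 3%nat) B 0 (Cd 2%nat ltac:(lia))
    (Dd 2%nat ltac:(lia)) (fun x Hx => B3 x (Hi x Hx)) I0 H20).
  destruct (rolle_I01 (d 0%nat) (d 1%nat)) as [c' [Hc' Hc1]];
    [apply Cd; lia|apply Dd; lia|now rewrite E0|now rewrite E0|].
  assert (B1 := bounded_of_derive (d 1%nat) (d 2%nat) B c' (Cd 1%nat ltac:(lia))
    (Dd 1%nat ltac:(lia)) (fun x Hx => B2 x (Hi x Hx)) (Hi c' Hc') Hc1).
  intros a b Ha Hb. rewrite <- !E0 by assumption.
  apply (lipschitz_of_derive (d 0%nat) (d 1%nat)); try easy;
    [apply Cd; lia|apply Dd; lia|auto].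
Qed.

(** * The iteration *)

Lemma RInt_unif_cv h q l : continuous_on I01 h -> (forall n, continuous_on I01 (q n)) ->
  continuous_on I01 l -> unif_cv q l ->
  is_lim_seq (fun n => RInt (fun s => h s * q n s) 0 1) (RInt (fun s => h s * l s) 0 1).
Proof.
  intros Hh Hq Hl Hcv. apply is_lim_seq_spec. intros eps.
  destruct (continuous_on_bounded h Hh) as [C [HC HhC]].
  assert (He : 0 < eps / (2 * (C + 1)))
    by (apply Rdiv_lt_0_compat; [apply cond_pos|lra]).
  destruct (Hcv _ He) as [n0 Hn0]. exists n0. intros n Hn.
  apply Rle_lt_trans with (eps / 2); [|assert (H := cond_pos eps); lra].
  apply RInt_I01_diff_le; try now apply continuous_on_mult.
  intros t Ht. rewrite <- Rmult_minus_distr_l, Rabs_mult.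
  replace (eps / 2) with ((C + 1) * (eps / (2 * (C + 1)))) by (field; lra).
  apply Rmult_le_compat; try apply Rabs_pos.
  - specialize (HhC t Ht). lra.
  - apply Rlt_le. now apply Hn0.
Qed.

Definition rhs (M N : R) (f : R -> R -> R -> R) (k : R -> R -> R)
    (u : R -> R) (x : R) : R :=
  f x (u x) (Kint k u x) + M * u x - N * Kint k u x.

Definition iterate (M N : R) (f : R -> R -> R -> R) (k : R -> R -> R)
    (u v : R -> R) : Prop :=
  exists d, is_Cn 4 v d /\
    (forall x, 0 < x < 1 -> Lop M N k v d x = rhs M N f k u x) /\ navier v d.

Lemma continuous_on_rhs M N f k u : continuous_f f -> continuous_square k ->
  continuous_on I01 u -> continuous_on I01 (rhs M N f k u).
Proof.
  intros Hf Hk Hu.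
  assert (HK := continuous_on_Kint k u Hk Hu).
  assert (Hfu : continuous_on I01 (fun x => f x (u x) (Kint k u x))).
  { rewrite continuous_on_I01_eps in *. intros x Hx eps Heps.
    destruct (continuous_f_eps f Hf x (u x) (Kint k u x) Hx eps Heps) as [e [He H]].
    destruct (Hu x Hx e He) as [d1 [Hd1 H1]]. destruct (HK x Hx e He) as [d2 [Hd2 H2]].
    exists (Rmin e (Rmin d1 d2)). split; [repeat apply Rmin_glb_lt; lra|].
    intros y Hy Hyx.
    assert (Rabs (y - x) < e /\ Rabs (y - x) < d1 /\ Rabs (y - x) < d2) as (A & A1 & A2)
      by (revert Hyx; unfold Rmin; repeat destruct Rle_dec; lra).
    apply H; auto. }
  apply continuous_on_ext with (fun x => 1 * f x (u x) (Kint k u x)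
    + 1 * (M * u x + - N * Kint k u x)).
  { intros x _. unfold rhs. lra. }
  repeat apply continuous_on_lincomb; assumption.
Qed.

Lemma Kint_ext k u v x : I01 x -> (forall t, I01 t -> u t = v t) -> Kint k u x = Kint k v x.
Proof. intros Hx H. apply RInt_I01_ext. intros t Ht. now rewrite H. Qed.

Lemma rhs_ext M N f k u v x : I01 x -> (forall t, I01 t -> u t = v t) ->
  rhs M N f k u x = rhs M N f k v x.
Proof. intros Hx H. unfold rhs. now rewrite (Kint_ext k u v x Hx H), H. Qed.

Lemma iterate_continuous M N f k u v : iterate M N f k u v -> continuous_on I01 v.
Proof. intros (d & Hv & _). now apply is_Cn_continuous_fun with 4%nat d. Qed.

Lemma iteration_continuous M N f k u0 u : continuous_on I01 u0 ->
  iteration M N f k u0 u -> forall n, continuous_on I01 (u n).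
Proof.
  intros Hu0 [H0 Hit] [|n].
  - apply continuous_on_ext with u0; [intros; symmetry; auto|easy].
  - exact (iterate_continuous M N f k (u n) (u (S n)) (Hit n)).
Qed.

Lemma iterate_mono M N f k u v w z : continuous_square k -> inverse_positive M N k ->
  iterate M N f k u v -> iterate M N f k w z ->
  (forall x, I01 x -> rhs M N f k u x <= rhs M N f k w x) ->
  forall x, I01 x -> v x <= z x.
Proof.
  intros Hk Hpos (d & Hv & HLv & V0 & V1 & V20 & V21) (e & Hz & HLz & Z0 & Z1 & Z20 & Z21) H.
  apply (inverse_positive_compare M N k v d z e); try assumption; try lra.
  intros x Hx. rewrite HLv, HLz by assumption. apply H. unfold I01; lra.
Qed.

Lemma solution_iterate M N f k y : solution f k y -> iterate M N f k y y.
Proof.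
  intros (d & Hy & Hode & Hn). exists d; split; [easy|split; [|easy]].
  intros x Hx. unfold Lop, rhs. rewrite Hode by assumption. ring.
Qed.

Lemma iterate_linear_solution M N f k u v : iterate M N f k u v ->
  linear_solution M (fun x => rhs M N f k u x + N * Kint k v x) v.
Proof.
  intros (d & Hv & HL & Hn). exists d; split; [easy|split; [|easy]].
  intros x Hx. specialize (HL x Hx). unfold Lop in HL. lra.
Qed.

Lemma fixed_point_solution M N f k y :
  linear_solution M (fun x => rhs M N f k y x + N * Kint k y x) y -> solution f k y.
Proof.
  intros (d & Hy & Hode & Hn). exists d; split; [easy|split; [|easy]].
  intros x Hx. specialize (Hode x Hx). unfold rhs in Hode. lra.
Qed.

Lemma linear_solution_ext M q y z : (forall x, I01 x -> y x = z x) ->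
  linear_solution M q y -> linear_solution M q z.
Proof.
  intros He (d & (Hy & HD & Hc) & Hode & Y0 & Y1 & Y2).
  assert (I0 : I01 0) by (unfold I01; lra). assert (I1 : I01 1) by (unfold I01; lra).
  exists d; split; [split; [|easy]|split; [|split; [|split]]].
  - intros x Hx. rewrite <- He by assumption. now apply Hy.
  - intros x Hx. rewrite <- He by (unfold I01; lra). now apply Hode.
  - now rewrite <- He.
  - now rewrite <- He.
  - easy.
Qed.

Lemma rhs_monotone M N f k alpha beta :
  continuous_square k -> (forall x t, I01 x -> I01 t -> 0 <= k x t) ->
  continuous_on I01 alpha -> continuous_on I01 beta ->
  (forall x u1 u2 v1 v2, I01 x ->
     alpha x <= u2 -> u2 <= u1 -> u1 <= beta x ->
     Kint k alpha x <= v2 -> v2 <= v1 -> v1 <= Kint k beta x ->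
     f x u1 v1 - f x u2 v2 >= - M * (u1 - u2) + N * (v1 - v2)) ->
  forall v w, continuous_on I01 v -> continuous_on I01 w ->
    (forall x, I01 x -> alpha x <= v x) -> (forall x, I01 x -> v x <= w x) ->
    (forall x, I01 x -> w x <= beta x) ->
    forall x, I01 x -> rhs M N f k v x <= rhs M N f k w x.
Proof.
  intros Hk Hk0 Ha Hb Hf v w Hv Hw Hav Hvw Hwb x Hx.
  assert (H := Hf x (w x) (v x) (Kint k w x) (Kint k v x) Hx
    (Hav x Hx) (Hvw x Hx) (Hwb x Hx)
    (Kint_mono k alpha v x Hk Hk0 Ha Hv Hav Hx)
    (Kint_mono k v w x Hk Hk0 Hv Hw Hvw Hx)
    (Kint_mono k w beta x Hk Hk0 Hw Hb Hwb Hx)).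
  unfold rhs. lra.
Qed.

Lemma lipschitz_continuous (y : R -> R) B :
  (forall a b, I01 a -> I01 b -> Rabs (y b - y a) <= B * Rabs (b - a)) ->
  continuous_on I01 y.
Proof.
  intros H. apply continuous_on_I01_eps. intros x Hx eps Heps.
  assert (HB : 0 < Rabs B + 1) by (assert (H0 := Rabs_pos B); lra).
  exists (eps / (Rabs B + 1)). split; [now apply Rdiv_lt_0_compat|].
  intros z Hz Hzx. eapply Rle_lt_trans; [now apply H|].
  replace eps with ((Rabs B + 1) * (eps / (Rabs B + 1))) by (field; lra).
  apply Rle_lt_trans with ((Rabs B + 1) * Rabs (z - x)).
  - apply Rmult_le_compat_r; [apply Rabs_pos|]. assert (H1 := Rle_abs B). lra.
  - now apply Rmult_lt_compat_l.
Qed.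

Lemma lipschitz_pointwise_cv (g : nat -> R -> R) (l : R -> R) B : pointwise_cv g l ->
  (forall n a b, I01 a -> I01 b -> Rabs (g n b - g n a) <= B * Rabs (b - a)) ->
  forall a b, I01 a -> I01 b -> Rabs (l b - l a) <= B * Rabs (b - a).
Proof.
  intros Hl Hg a b Ha Hb.
  apply (is_lim_seq_le (fun n => Rabs (g n b - g n a)) (fun _ => B * Rabs (b - a))
    (Rabs (l b - l a)) (B * Rabs (b - a))); [intros; now apply Hg| |apply is_lim_seq_const].
  apply (is_lim_seq_abs _ (l b - l a)). now apply is_lim_seq_minus'; apply Hl.
Qed.

Lemma is_lim_seq_f f x (u v : nat -> R) (a b : R) : continuous_f f -> I01 x ->
  is_lim_seq u a -> is_lim_seq v b ->
  is_lim_seq (fun n => f x (u n) (v n)) (f x a b).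
Proof.
  intros Hf Hx Hu Hv. apply is_lim_seq_spec. intros eps.
  destruct (continuous_f_eps f Hf x a b Hx eps (cond_pos eps)) as [d [Hd H]].
  apply is_lim_seq_spec in Hu, Hv.
  destruct (Hu (mkposreal d Hd)) as [n1 H1]. destruct (Hv (mkposreal d Hd)) as [n2 H2].
  exists (max n1 n2). intros n Hn. apply H; [easy| | |].
  - now rewrite Rminus_diag, Rabs_R0.
  - apply H1; lia.
  - apply H2; lia.
Qed.

(** Stated for increasing and for decreasing iterations at once, as it serves both
    sequences.  The limit is shown to be a solution through the integral equation
    with kernel G, so that no convergence of derivatives has to be proved. *)
Lemma iteration_converges M N f k G alpha beta u0 u :
  0 <= M -> 0 <= N -> continuous_f f -> continuous_square k ->
  (forall x t, I01 x -> I01 t -> 0 <= k x t) ->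
  is_green M G -> continuous_on I01 alpha -> continuous_on I01 beta ->
  (forall v w, continuous_on I01 v -> continuous_on I01 w ->
    (forall x, I01 x -> alpha x <= v x) -> (forall x, I01 x -> v x <= w x) ->
    (forall x, I01 x -> w x <= beta x) ->
    forall x, I01 x -> rhs M N f k v x <= rhs M N f k w x) ->
  continuous_on I01 u0 -> iteration M N f k u0 u ->
  (forall n x, I01 x -> alpha x <= u n x <= beta x) -> monotone_seq u ->
  exists y, solution f k y /\ between alpha beta y /\ pointwise_cv u y /\ unif_cv u y.
Proof.
  intros HM HN Hf Hk Hk0 [HGc HG] Ca Cb Hrhs Cu0 Hit Hbd Hmono.
  assert (Cu := iteration_continuous M N f k u0 u Cu0 Hit).
  assert (Hu : forall n, iterate M N f k (u n) (u (S n))) by apply Hit.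
  set (y := fun x => real (Lim_seq (fun n => u n x))).
  assert (Hpt : pointwise_cv u y).
  { intros x Hx. apply Lim_seq_correct'.
    destruct Hmono as [H|H];
      [apply ex_finite_lim_seq_incr with (beta x)
      |apply ex_finite_lim_seq_decr with (alpha x)];
      intros n; try apply H; try apply Hbd; assumption. }
  assert (Hybd : forall x, I01 x -> alpha x <= y x <= beta x).
  { intros x Hx. split.
    - apply (is_lim_seq_le (fun _ => alpha x) (fun n => u n x) (alpha x) (y x));
        [intros; now apply Hbd|apply is_lim_seq_const|auto].
    - apply (is_lim_seq_le (fun n => u n x) (fun _ => beta x) (y x) (beta x));
        [intros; now apply Hbd|auto|apply is_lim_seq_const]. }
  set (q := fun n x => rhs M N f k (u n) x + N * Kint k (u (S n)) x).
  assert (Cq : forall v w, continuous_on I01 v -> continuous_on I01 w ->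
    continuous_on I01 (fun x => rhs M N f k v x + N * Kint k w x)).
  { intros v w Hv Hw. apply continuous_on_plus; [now apply continuous_on_rhs|].
    apply continuous_on_mult; [apply continuous_on_const|now apply continuous_on_Kint]. }
  (* The equation expresses y_(n+1)'''' through quantities that are trapped
     between their values at alpha and at beta. *)
  assert (Hlip : exists B, forall n a b, I01 a -> I01 b ->
    Rabs (u (S n) b - u (S n) a) <= B * Rabs (b - a)).
  { destruct (continuous_on_bounded (fun x =>
      (rhs M N f k alpha x + N * Kint k alpha x) + - M * beta x)) as [A [_ HA]].
    { apply continuous_on_plus; [now apply Cq|].
      apply continuous_on_mult; [apply continuous_on_const|easy]. }
    destruct (continuous_on_bounded (fun x =>
      (rhs M N f k beta x + N * Kint k beta x) + - M * alpha x)) as [B [_ HB]].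
    { apply continuous_on_plus; [now apply Cq|].
      apply continuous_on_mult; [apply continuous_on_const|easy]. }
    exists (A + B). intros n. destruct (Hu n) as (d & Hd & HL & Hnav).
    apply (navier_lipschitz _ d); [easy|easy|].
    intros x Hx. assert (Hx' : I01 x) by (unfold I01; lra).
    specialize (HL x Hx). unfold Lop in HL.
    assert (R1 := Hrhs alpha (u n) Ca (Cu n) (fun t _ => Rle_refl _)
      (fun t Ht => proj1 (Hbd n t Ht)) (fun t Ht => proj2 (Hbd n t Ht)) x Hx').
    assert (R2 := Hrhs (u n) beta (Cu n) Cb (fun t Ht => proj1 (Hbd n t Ht))
      (fun t Ht => proj2 (Hbd n t Ht)) (fun t _ => Rle_refl _) x Hx').
    assert (K1 := Kint_mono k alpha (u (S n)) x Hk Hk0 Ca (Cu (S n))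
      (fun t Ht => proj1 (Hbd (S n) t Ht)) Hx').
    assert (K2 := Kint_mono k (u (S n)) beta x Hk Hk0 (Cu (S n)) Cb
      (fun t Ht => proj2 (Hbd (S n) t Ht)) Hx').
    apply (Rmult_le_compat_l N) in K1, K2; [|easy..].
    destruct (Hbd (S n) x Hx') as [U1 U2].
    apply (Rmult_le_compat_l M) in U1, U2; [|easy..].
    specialize (HA x Hx'). specialize (HB x Hx'). cbv beta in HA, HB.
    revert HA HB. unfold Rabs; repeat destruct Rcase_abs; lra. }
  destruct Hlip as [B HB].
  assert (Hpt' : pointwise_cv (fun n => u (S n)) y).
  { intros x Hx. apply (is_lim_seq_incr_1 (fun n => u n x)). auto. }
  assert (Cy : continuous_on I01 y).
  { apply lipschitz_continuous with B. eapply lipschitz_pointwise_cv; eassumption. }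
  assert (Hunif : unif_cv u y) by now apply dini.
  assert (HK : pointwise_cv (fun n => Kint k (u n)) (Kint k y)).
  { intros x Hx. apply RInt_unif_cv; try assumption. now apply continuous_square_slice. }
  set (qy := fun x => rhs M N f k y x + N * Kint k y x).
  assert (Hq : unif_cv q qy).
  { apply dini.
    - intros n. now apply Cq.
    - now apply Cq.
    - destruct Hmono as [H|H]; [left|right]; intros n x Hx; unfold q.
      + apply Rplus_le_compat.
        * apply Hrhs; auto; intros; now apply Hbd.
        * apply Rmult_le_compat_l; [easy|]. apply Kint_mono; auto.
      + apply Rplus_le_compat.
        * apply Hrhs; auto; intros; now apply Hbd.
        * apply Rmult_le_compat_l; [easy|]. apply Kint_mono; auto.
    - intros x Hx. unfold q, qy, rhs.
      assert (HKx := HK x Hx). assert (Hux := Hpt x Hx).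
      apply is_lim_seq_plus'.
      + apply is_lim_seq_minus'; [apply is_lim_seq_plus'|].
        * now apply is_lim_seq_f.
        * now apply (is_lim_seq_scal_l _ M (y x)).
        * now apply (is_lim_seq_scal_l _ N (Kint k y x)).
      + apply (is_lim_seq_scal_l (fun n => Kint k (u (S n)) x) N (Kint k y x)).
        now apply (is_lim_seq_incr_1 (fun n => Kint k (u n) x)). }
  exists y. split; [|split; [|split]]; [|now split|easy|easy].
  apply fixed_point_solution with M N.
  apply linear_solution_ext with (fun x => RInt (fun s => G x s * qy s) 0 1).
  2: { apply (HG qy). now apply Cq. }
  intros x Hx.
  assert (L1 : is_lim_seq (fun n => u (S n) x) (RInt (fun s => G x s * qy s) 0 1)).
  { apply is_lim_seq_ext with (fun n => RInt (fun s => G x s * q n s) 0 1).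
    - intros n. symmetry. apply (HG (q n)); [now apply Cq| |easy].
      apply (iterate_linear_solution M N f k (u n) (u (S n))), Hu.
    - apply RInt_unif_cv; [now apply continuous_square_slice|intros; now apply Cq|now apply Cq|easy]. }
  assert (E1 := is_lim_seq_unique _ _ L1). assert (E2 := is_lim_seq_unique _ _ (Hpt' x Hx)).
  now injection (eq_trans (eq_sym E1) E2).
Qed.

Theorem theorem3p1
    (f : R -> R -> R -> R) (k : R -> R -> R)
    (hf : continuous_f f)
    (hk : continuous_square k)
    (hk0 : forall x t, I01 x -> I01 t -> 0 <= k x t)
    (alpha beta : R -> R)
    (halpha : lower_solution f k alpha)
    (hbeta : upper_solution f k beta)
    (hab : forall x, I01 x -> alpha x <= beta x)
    (M N c1 : R) (hM : 0 < M) (hN : 0 < N)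
    (hc1 : is_c1 c1) (hMc1 : M < c1)
    (G : R -> R -> R) (hG : is_green M G)
    (knorm gmax : R)
    (hknorm : is_sup_norm k knorm)
    (hgmax : is_max_int_green G gmax)
    (hbound : knorm < 1 / (N * gmax))
    (hfMN : forall x u1 u2 v1 v2, I01 x ->
       alpha x <= u2 -> u2 <= u1 -> u1 <= beta x ->
       Kint k alpha x <= v2 -> v2 <= v1 -> v1 <= Kint k beta x ->
       f x u1 v1 - f x u2 v2 >= - M * (u1 - u2) + N * (v1 - v2))
    (alpha_ beta_ : nat -> R -> R)
    (halpha_ : iteration M N f k alpha alpha_)
    (hbeta_ : iteration M N f k beta beta_) :
  (forall n x, I01 x ->
     alpha_ n x <= alpha_ (S n) x /\
     alpha_ (S n) x <= beta_ (S n) x /\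
     beta_ (S n) x <= beta_ n x) /\
  (exists ymin ymax : R -> R,
     extremal_solutions f k alpha beta ymin ymax /\
     unif_cv alpha_ ymin /\ unif_cv beta_ ymax).
Proof.
  assert (Hkn : forall x t, I01 x -> I01 t -> 0 <= k x t <= knorm).
  { intros x t Hx Ht. split; [auto|]. eapply Rle_trans; [apply Rle_abs|].
    apply hknorm. now exists x, t. }
  assert (I0 : I01 0) by (unfold I01; lra). assert (I1 : I01 1) by (unfold I01; lra).
  assert (Hkn0 : 0 <= knorm) by (destruct (Hkn 0 0 I0 I0); lra).
  (* The denominator N * gmax can be cleared when gmax > 0; otherwise the product
     is nonpositive. *)
  assert (Hsmall : N * knorm * gmax < 1).
  { destruct (Rle_lt_dec gmax 0) as [Hg|Hg].
    - assert (0 <= N * knorm * - gmax)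
        by (apply Rmult_le_pos; [apply Rmult_le_pos|]; lra). lra.
    - assert (Hp : 0 < N * gmax) by now apply Rmult_lt_0_compat.
      apply (Rmult_lt_compat_r (N * gmax)) in hbound; [|easy].
      replace (1 / (N * gmax) * (N * gmax)) with 1 in hbound by (field; lra). lra. }
  assert (HP : inverse_positive M N k).
  { apply (nonlocal_inverse_positive M N k knorm G gmax); try assumption; [lra| |].
    - now apply (beam_inverse_positive M c1).
    - intros x Hx. apply hgmax. now exists x. }
  assert (Ca : continuous_on I01 alpha).
  { destruct halpha as (d & Hd & _). now apply is_Cn_continuous_fun with 4%nat d. }
  assert (Cb : continuous_on I01 beta).
  { destruct hbeta as (d & Hd & _). now apply is_Cn_continuous_fun with 4%nat d. }
  assert (Hrhs := rhs_monotone M N f k alpha beta hk hk0 Ca Cb hfMN).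
  assert (Ca_ := iteration_continuous M N f k alpha alpha_ Ca halpha_).
  assert (Cb_ := iteration_continuous M N f k beta beta_ Cb hbeta_).
  assert (Ia : forall n, iterate M N f k (alpha_ n) (alpha_ (S n))) by apply halpha_.
  assert (Ib : forall n, iterate M N f k (beta_ n) (beta_ (S n))) by apply hbeta_.
  assert (Ea := proj1 halpha_). assert (Eb := proj1 hbeta_).
  assert (Hstep : forall u u' w w', continuous_on I01 u -> continuous_on I01 w ->
    iterate M N f k u u' -> iterate M N f k w w' ->
    (forall x, I01 x -> alpha x <= u x) -> (forall x, I01 x -> u x <= w x) ->
    (forall x, I01 x -> w x <= beta x) -> forall x, I01 x -> u' x <= w' x).
  { intros u u' w w' Cu Cw Hu Hw H1 H2 H3.
    apply (iterate_mono M N f k u u' w w'); auto. }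
  assert (A1 : forall x, I01 x -> alpha x <= alpha_ 1%nat x).
  { destruct halpha as (d & Hd & Hode & A0 & A1 & A20 & A21).
    destruct (Ia 0%nat) as (e & He & HL & E0 & E1 & E20 & E21).
    apply (inverse_positive_compare M N k _ d _ e); try assumption; try lra.
    intros x Hx. assert (Hx' : I01 x) by (unfold I01; lra).
    rewrite HL by assumption. rewrite (rhs_ext M N f k _ alpha x Hx' Ea).
    specialize (Hode x Hx). unfold Lop, rhs. lra. }
  assert (B1 : forall x, I01 x -> beta_ 1%nat x <= beta x).
  { destruct hbeta as (d & Hd & Hode & A0 & A1' & A20 & A21).
    destruct (Ib 0%nat) as (e & He & HL & E0 & E1 & E20 & E21).
    apply (inverse_positive_compare M N k _ e _ d); try assumption; try lra.
    intros x Hx. assert (Hx' : I01 x) by (unfold I01; lra).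
    rewrite HL by assumption. rewrite (rhs_ext M N f k _ beta x Hx' Eb).
    specialize (Hode x Hx). unfold Lop, rhs. lra. }
  assert (Hord : forall n,
    (forall x, I01 x -> alpha x <= alpha_ n x) /\
    (forall x, I01 x -> alpha_ n x <= alpha_ (S n) x) /\
    (forall x, I01 x -> alpha_ (S n) x <= beta_ (S n) x) /\
    (forall x, I01 x -> beta_ (S n) x <= beta_ n x) /\
    (forall x, I01 x -> beta_ n x <= beta x)).
  { induction n as [|n (H1 & H2 & H3 & H4 & H5)].
    - assert (H1 : forall x, I01 x -> alpha x <= alpha_ 0%nat x)
        by (intros x Hx; rewrite Ea by easy; lra).
      assert (H5 : forall x, I01 x -> beta_ 0%nat x <= beta x)
        by (intros x Hx; rewrite Eb by easy; lra).
      repeat split; auto; intros x Hx.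
      + rewrite Ea by easy. auto.
      + apply (Hstep (alpha_ 0%nat) _ (beta_ 0%nat) _); auto.
        intros t Ht. rewrite Ea, Eb by easy. auto.
      + rewrite (Eb x) by easy. auto.
    - assert (Ha : forall x, I01 x -> alpha x <= alpha_ (S n) x)
        by (intros x Hx; specialize (H1 x Hx); specialize (H2 x Hx); lra).
      assert (Hb : forall x, I01 x -> beta_ (S n) x <= beta x)
        by (intros x Hx; specialize (H4 x Hx); specialize (H5 x Hx); lra).
      assert (Hab' : forall x, I01 x -> alpha_ (S n) x <= beta x)
        by (intros x Hx; specialize (H3 x Hx); specialize (Hb x Hx); lra).
      assert (Hba' : forall x, I01 x -> alpha x <= beta_ (S n) x)
        by (intros x Hx; specialize (H3 x Hx); specialize (Ha x Hx); lra).
      split; [easy|]. split; [|split; [|split; [|easy]]].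
      + now apply (Hstep (alpha_ n) _ (alpha_ (S n)) _).
      + now apply (Hstep (alpha_ (S n)) _ (beta_ (S n)) _).
      + now apply (Hstep (beta_ (S n)) _ (beta_ n) _). }
  split.
  { intros n x Hx. destruct (Hord n) as (_ & H2 & H3 & H4 & _). auto. }
  assert (Hin : forall n x, I01 x ->
    alpha x <= alpha_ n x /\ alpha_ n x <= beta_ n x /\ beta_ n x <= beta x).
  { intros n x Hx. destruct (Hord n) as (H1 & H2 & H3 & H4 & H5).
    specialize (H1 x Hx); specialize (H2 x Hx); specialize (H3 x Hx);
      specialize (H4 x Hx); specialize (H5 x Hx). lra. }
  destruct (iteration_converges M N f k G alpha beta alpha alpha_)
    as (ymin & Smin & Bmin & Pmin & Umin); try assumption; try lra.
  { intros n x Hx. destruct (Hin n x Hx) as (? & ? & ?). lra. }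
  { left. intros n x Hx. now apply (Hord n). }
  destruct (iteration_converges M N f k G alpha beta beta beta_)
    as (ymax & Smax & Bmax & Pmax & Umax); try assumption; try lra.
  { intros n x Hx. destruct (Hin n x Hx) as (? & ? & ?). lra. }
  { right. intros n x Hx. now apply (Hord n). }
  exists ymin, ymax. split; [|split; assumption].
  split; [easy|split; [easy|]].
  intros y Sy [Cy By].
  assert (Iy := solution_iterate M N f k y Sy).
  assert (Hyn : forall n, (forall x, I01 x -> alpha_ n x <= y x) /\
    (forall x, I01 x -> y x <= beta_ n x)).
  { induction n as [|n [IH1 IH2]].
    - split; intros x Hx; [rewrite Ea|rewrite Eb]; try easy; now apply By.
    - split.
      + apply (Hstep (alpha_ n) _ y y); auto; intros t Ht; [now apply Hin|now apply By].
      + apply (Hstep y y (beta_ n) _); auto; intros t Ht; [now apply By|now apply Hin]. }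
  intros x Hx. split.
  - apply (is_lim_seq_le (fun n => alpha_ n x) (fun _ => y x) (ymin x) (y x));
      [intros n; now apply Hyn|auto|apply is_lim_seq_const].
  - apply (is_lim_seq_le (fun _ => y x) (fun n => beta_ n x) (y x) (ymax x));
      [intros n; now apply Hyn|apply is_lim_seq_const|auto].
Qed.
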